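(* Let $k$ be a commutative ring with $1$, let $M$ be a finitely generated projective $k$-module of rank $9$, and suppose there exist $u\in\Lambda_9(M)$ and $\mu\in\Lambda_9(M^* )$ with $\mu\cdot u=1$. Then $$\mathcal{G}(M,u)=\widetilde{sl}(M)\oplus\Lambda_3(M)\oplus\Lambda_3(M^* )$$ is a Lie algebra over $k$ with skew-symmetric product given by $$[\alpha,\beta]=\alpha\beta-\beta\alpha,\qquad [\alpha,x]=\alpha(x),\qquad [\alpha,\xi]=-\alpha^*(\xi),$$ $$[x,y]=(xy)\cdot\mu,\qquad [\xi,\psi]=(\xi\psi)\cdot u,\qquad [x,\xi]=\delta(x,\xi):=\rho_M(e(x,\xi))-(x\cdot\xi)\,\mathrm{Id}_{\Lambda_3(M)}$$ for $\alpha,\beta\in\widetilde{sl}(M)$, $x,y\in\Lambda_3(M)$, and $\xi,\psi\in\Lambda_3(M^* )$.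
   Context: Conventions. $k$ is a commutative ring with $1$; all modules are unital. $M^*=\mathrm{Hom}_k(M,k)$. A finitely generated projective module $M$ has rank $n$ if $M_{\mathfrak p}$ is free of rank $n$ over $k_{\mathfrak p}$ for every prime ideal $\mathfrak p$ of $k$; $M$ is identified with $M^{**}$. $gl(M)=\mathrm{End}_k(M)$. The trace $tr$ on $\mathrm{End}_k(M)$ is the linear map sending $m'\mapsto\phi(m')m$ to $\phi(m)$ for $m\in M$, $\phi\in M^*$. Exterior algebra. $\Lambda(M)=\bigoplus_{i\ge 0}\Lambda_i(M)$, with product written $xy$. Each $\alpha\in gl(M)$ extends uniquely to a derivation $D_\alpha$ of $\Lambda(M)$. Each $\phi\in M^*$ extends uniquely to an antiderivation $\Delta_\phi$ of $\Lambda(M)$ (i.e. $\Delta(xy)=\Delta(x)y+(-1)^{i}x\Delta(y)$ for $x\in\Lambda_i(M)$) with $\Delta_\phi(m)=\phi(m)$ for $m\in M$. The map $\phi\mapsto\Delta_\phi$ extends to an algebra homomorphism $\xi\mapsto\Delta_\xi$, $\Lambda(M^* )\to\mathrm{End}_k(\Lambda(M))$, and one writes $\xi\cdot x=\Delta_\xi(x)$; so $(\xi\xi')\cdot x=\xi\cdot(\xi'\cdot x)$ and $\Lambda_i(M^* )\cdot\Lambda_j(M)\subset\Lambda_{j-i}(M)$. Reversing the roles of $M$ and $M^*$ gives $x\cdot\xi\in\Lambda(M^* )$. $\Lambda_i(M^* )$ is identified with $\Lambda_i(M)^*$ via $\xi(x)=\xi\cdot x$. For an endomorphism $\alpha$,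 $\alpha^*(\phi)=\phi\alpha$; in particular for $\alpha\in\mathrm{End}_k(\Lambda_3(M))$, $\alpha^*\in\mathrm{End}_k(\Lambda_3(M^* ))$. For $x\in\Lambda_l(M)$, $\xi\in\Lambda_l(M^* )$, $e(x,\xi)\in\mathrm{End}_k(M)$ is $e(x,\xi)(m)=(m\cdot\xi)\cdot x$. The algebra $\widetilde{sl}(M)$ (for $M,u,\mu$ as in the claim). $\rho_M(\alpha)=D_\alpha|_{\Lambda_3(M)}$ for $\alpha\in gl(M)$, and $\widetilde{gl}(M)=\rho_M(gl(M))+k\,\mathrm{Id}_{\Lambda_3(M)}$, a Lie subalgebra of $\mathrm{End}_k(\Lambda_3(M))$. Each $\beta\in\widetilde{gl}(M)$ extends uniquely to a derivation $d_\beta$ of the subalgebra $k\oplus\Lambda_3(M)\oplus\Lambda_6(M)\oplus\Lambda_9(M)$ of $\Lambda(M)$; set $T(\beta)=\mu\cdot d_\beta(u)\in k$ (so $T(\rho_M(\alpha))=tr(\alpha)$ and $T(\mathrm{Id}_{\Lambda_3(M)})=3$). $\widetilde{sl}(M)=\{\beta\in\widetilde{gl}(M):T(\beta)=0\}$. The element $\mu$ is uniquely determined by $u$. *)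

(* Defs.v *)
From HB Require Import structures.
From mathcomp Require Import all_boot all_algebra ring.
From mathcomp Require Import boolp classical_sets functions.

Set Implicit Arguments.
Unset Strict Implicit.
Unset Printing Implicit Defensive.

Import GRing.Theory.
Local Open Scope ring_scope.
Local Open Scope quotient_scope.

(** * Modules of linear maps *)

Section Hom.
Variables (k : comPzRingType) (U V : lmodType k).

Definition is_linear : {pred U -> V} := fun f => `[< linear f >].

Record hom := Hom { hom_fun :> U -> V; hom_linear : hom_fun \in is_linear }.

HB.instance Definition _ := [isSub for hom_fun].
HB.instance Definition _ := [Choice of hom by <:].

Fact is_linear_closed : GRing.subsemimod_closed is_linear.
Proof.
split; first split.
- by apply/asboolP => a x y /=; rewrite scaler0 addr0.
- move=> f g /asboolP lf /asboolP lg; apply/asboolP => a x y /=.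
  by rewrite [LHS](congr2 +%R (lf a x y) (lg a x y)) scalerDr addrACA.
- move=> b f /asboolP lf; apply/asboolP => a x y.
  rewrite [LHS](congr1 ( *:%R b) (lf a x y)) scalerDr !scalerA.
  by rewrite mulrC -scalerA.
Qed.

HB.instance Definition _ :=
  GRing.SubChoice_isSubLmodule.Build k (U -> V) is_linear hom is_linear_closed.

Fact hom_is_linear (f : hom) : linear f.
Proof. exact/asboolP/hom_linear. Qed.

HB.instance Definition _ (f : hom) :=
  GRing.isLinear.Build k U V *:%R f (hom_is_linear f).

Definition mkhom (f : U -> V) (lf : linear f) : hom := Hom (asboolT lf).

Lemma homP (f g : hom) : f =1 g -> f = g.
Proof. by move=> fg; apply/val_inj/funext. Qed.

Lemma hom0E x : (0 : hom) x = 0. Proof. by []. Qed.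
Lemma homDE (f g : hom) x : (f + g) x = f x + g x. Proof. by []. Qed.
Lemma homNE (f : hom) x : (- f) x = - f x. Proof. by []. Qed.
Lemma homZE a (f : hom) x : (a *: f) x = a *: f x. Proof. by []. Qed.

Lemma homf0 (f : hom) : f 0 = 0. Proof. exact: linear0. Qed.
Lemma homfD (f : hom) x y : f (x + y) = f x + f y. Proof. exact: linearD. Qed.
Lemma homfN (f : hom) x : f (- x) = - f x. Proof. exact: linearN. Qed.
Lemma homfZ (f : hom) a x : f (a *: x) = a *: f x. Proof. exact: linearZZ. Qed.
Lemma homfP (f : hom) a x y : f (a *: x + y) = a *: f x + f y.
Proof. exact: linearP. Qed.

Lemma mkhomE (f : U -> V) (lf : linear f) x : mkhom lf x = f x.
Proof. by []. Qed.

End Hom.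

Arguments hom_fun : simpl never.

Section HomComp.
Variable k : comPzRingType.

Fact hom_comp_linear (U V W : lmodType k) (g : hom V W) (f : hom U V) :
  linear (g \o f).
Proof. by move=> a x y /=; rewrite !linearP. Qed.

Definition hom_comp U V W (g : hom V W) (f : hom U V) : hom U W :=
  mkhom (@hom_comp_linear U V W g f).

Fact hom_id_linear (U : lmodType k) : linear (@idfun U).
Proof. by []. Qed.

Definition hom_id (U : lmodType k) : hom U U := mkhom (@hom_id_linear U).

Section EndRing.
Variable U : lmodType k.
Implicit Types f g h : hom U U.

Fact hom_mulA : associative (fun f g : hom U U => hom_comp f g).
Proof. by move=> f g h; apply: homP. Qed.
Fact hom_mul1 : left_id (hom_id U) (fun f g : hom U U => hom_comp f g).
Proof. by move=> f; apply: homP. Qed.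
Fact hom_mulr1 : right_id (hom_id U) (fun f g : hom U U => hom_comp f g).
Proof. by move=> f; apply: homP. Qed.
Fact hom_mulDl :
  left_distributive (fun f g : hom U U => hom_comp f g) +%R.
Proof. by move=> f g h; apply: homP. Qed.
Fact hom_mulDr :
  right_distributive (fun f g : hom U U => hom_comp f g) +%R.
Proof. by move=> f g h; apply: homP => x; exact: linearD. Qed.

HB.instance Definition _ := GRing.Zmodule_isPzRing.Build (hom U U)
  hom_mulA hom_mul1 hom_mulr1 hom_mulDl hom_mulDr.

Lemma homME f g x : (f * g) x = f (g x). Proof. by []. Qed.
Lemma hom1E x : (1 : hom U U) x = x. Proof. by []. Qed.

End EndRing.

Definition dual (M : lmodType k) : lmodType k := hom M k^o.

Definition transpose (U V : lmodType k) (f : hom U V) (phi : dual V) : dual U :=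
  hom_comp phi f.

Definition evdual_fun (M : lmodType k) (m : M) (phi : dual M) : k^o :=
  (phi : hom M k^o) m.

Fact evdual_fun_linear (M : lmodType k) (m : M) : linear (evdual_fun m).
Proof. by []. Qed.

Fact evdual_linear (M : lmodType k) :
  linear (fun m : M => mkhom (evdual_fun_linear m) : dual (dual M)).
Proof. by move=> a x y; apply: homP => phi; exact: linearP. Qed.

Definition evdual (M : lmodType k) : hom M (dual (dual M)) :=
  mkhom (@evdual_linear M).

End HomComp.

(** * Localization at a prime ideal, rank, finitely generated projective modules *)

Section Localization.
Variable k : comPzRingType.

Record prime_ideal := PrimeIdeal {
  prime_set :> set k;
  prime0 : prime_set 0;
  primeN1 : ~ prime_set 1;
  primeMD : forall a x y,
    prime_set x -> prime_set y -> prime_set (a * x + y);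
  primeP : forall x y,
    prime_set (x * y) -> prime_set x \/ prime_set y }.

Variable p : prime_ideal.

Definition not_in_prime : {pred k} := fun s => `[< ~ prime_set p s >].

Record denom := Denom { den :> k; denP : den \in not_in_prime }.

HB.instance Definition _ := [isSub for den].
HB.instance Definition _ := [Choice of denom by <:].

Fact den1_subproof : 1 \in not_in_prime.
Proof. exact/asboolP/primeN1. Qed.
Definition den1 := Denom den1_subproof.

Fact denM_subproof (s t : denom) : den s * den t \in not_in_prime.
Proof.
have ps := asboolW (denP s); have pt := asboolW (denP t).
by apply: asboolT => /primeP [].
Qed.
Definition denM s t := Denom (denM_subproof s t).

Section Module.
Variable M : lmodType k.

Definition loc_eq : rel (M * denom) := fun x y =>
  `[< exists t : denom, den t *: (den y.2 *: x.1 - den x.2 *: y.1) = 0 >].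

Lemma loc_eqP (x y : M * denom) :
  reflect (exists t : denom,
            (den t * den y.2) *: x.1 = (den t * den x.2) *: y.1)
          (loc_eq x y).
Proof.
apply: (iffP (asboolP _)) => -[t h]; exists t.
  by apply/eqP; rewrite -!scalerA -subr_eq0 -scalerBr h.
by rewrite scalerBr !scalerA h subrr.
Qed.

Fact loc_eq_refl : reflexive loc_eq.
Proof. by move=> x; apply/loc_eqP; exists den1. Qed.

Fact loc_eq_sym : symmetric loc_eq.
Proof. by move=> x y; apply/loc_eqP/loc_eqP => -[t e]; exists t. Qed.

Fact loc_eq_trans : transitive loc_eq.
Proof.
move=> y x z /loc_eqP[t e] /loc_eqP[t' e']; apply/loc_eqP.
exists (denM (denM t t') y.2) => /=.
have -> : den t * den t' * den y.2 * den z.2 =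
  (den t' * den z.2) * (den t * den y.2) by ring.
rewrite -scalerA e scalerA.
have -> : den t' * den z.2 * (den t * den x.2) =
  (den t * den x.2) * (den t' * den z.2) by ring.
by rewrite -scalerA e' scalerA; congr (_ *: _); ring.
Qed.

Canonical loc_equiv := EquivRel loc_eq loc_eq_refl loc_eq_sym loc_eq_trans.

(* M_p, with [mkloc m s] the fraction m / s; k_p is [loc_ring] below. *)
Definition loc := {eq_quot loc_eq}.

HB.instance Definition _ := Choice.on loc.
HB.instance Definition _ := EqQuotient.on loc.

Definition mkloc (m : M) (s : denom) : loc := \pi_loc (m, s).

Lemma mkloc_eq m s n t :
  mkloc m s = mkloc n t <->
  exists r : denom, (den r * den t) *: m = (den r * den s) *: n.
Proof.
split=> [/eqP|h]; first by rewrite eqmodE => /loc_eqP.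
by apply/eqP; rewrite eqmodE; apply/loc_eqP.
Qed.

Lemma locP (x : loc) : exists m s, x = mkloc m s.
Proof. by exists (repr x).1, (repr x).2; rewrite /mkloc -surjective_pairing reprK. Qed.

Definition loc_add (x y : loc) : loc :=
  let: (m, s) := repr x in let: (n, t) := repr y in
  mkloc (den t *: m + den s *: n) (denM s t).

Definition loc_opp (x : loc) : loc := let: (m, s) := repr x in mkloc (- m) s.

Lemma repr_mkloc m s : mkloc (repr (mkloc m s)).1 (repr (mkloc m s)).2 = mkloc m s.
Proof. by rewrite /mkloc -surjective_pairing reprK. Qed.

Lemma loc_addE m s n t :
  loc_add (mkloc m s) (mkloc n t) =
  mkloc (den t *: m + den s *: n) (denM s t).
Proof.
rewrite /loc_add; move: (repr_mkloc m s) (repr_mkloc n t).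
case: (repr _) => m' s'; case: (repr _) => n' t' /= /mkloc_eq[r e] /mkloc_eq[q f].
apply/mkloc_eq; exists (denM r q); rewrite /= !scalerDr !scalerA.
congr (_ + _).
- have -> : den r * den q * (den s * den t) * den t' =
    (den q * den t * den t') * (den r * den s) by ring.
  by rewrite -scalerA e scalerA; congr (_ *: _); ring.
- have -> : den r * den q * (den s * den t) * den s' =
    (den r * den s * den s') * (den q * den t) by ring.
  by rewrite -scalerA f scalerA; congr (_ *: _); ring.
Qed.

Lemma loc_oppE m s : loc_opp (mkloc m s) = mkloc (- m) s.
Proof.
rewrite /loc_opp; move: (repr_mkloc m s).
case: (repr _) => m' s' /= /mkloc_eq[r e].
by apply/mkloc_eq; exists r; rewrite !scalerN e.
Qed.

Fact loc_addA : associative loc_add.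
Proof.
move=> x y z.
have [m [s ->]] := locP x.
have [n [t ->]] := locP y.
have [o [r ->]] := locP z.
rewrite !loc_addE; apply/mkloc_eq; exists den1 => /=.
rewrite !scalerDr !scalerA !addrA.
by congr (_ *: _ + _ *: _ + _ *: _); ring.
Qed.

Fact loc_addC : commutative loc_add.
Proof.
move=> x y.
have [m [s ->]] := locP x.
have [n [t ->]] := locP y.
rewrite !loc_addE addrC; apply/mkloc_eq; exists den1 => /=.
by rewrite !scalerDr !scalerA; congr (_ *: _ + _ *: _); ring.
Qed.

Fact loc_add0 : left_id (mkloc 0 den1) loc_add.
Proof.
move=> x; have [m [s ->]] := locP x.
rewrite loc_addE scaler0 add0r; apply/mkloc_eq; exists den1 => /=.
by rewrite !scalerA; congr (_ *: _); ring.
Qed.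

Fact loc_addN : left_inverse (mkloc 0 den1) loc_opp loc_add.
Proof.
move=> x; have [m [s ->]] := locP x.
rewrite loc_oppE loc_addE scalerN addNr; apply/mkloc_eq; exists den1 => /=.
by rewrite !scaler0.
Qed.

HB.instance Definition _ := GRing.isZmodule.Build loc
  loc_addA loc_addC loc_add0 loc_addN.

Lemma mklocD m s n t :
  mkloc m s + mkloc n t = mkloc (den t *: m + den s *: n) (denM s t).
Proof. exact: loc_addE. Qed.

End Module.

Definition loc_scale (M : lmodType k) (a : loc k^o) (x : loc M) : loc M :=
  let: (b, s) := repr a in let: (m, t) := repr x in
  mkloc ((b : k) *: m) (denM s t).

Lemma loc_scaleE (M : lmodType k) (b : k) s (m : M) t :
  loc_scale (mkloc (b : k^o) s) (mkloc m t) = mkloc (b *: m) (denM s t).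
Proof.
rewrite /loc_scale; move: (repr_mkloc (b : k^o) s) (repr_mkloc m t).
case: (repr _) => b' s'; case: (repr _) => m' t' /= /mkloc_eq[r e] /mkloc_eq[q f].
have {}e : den r * den s * b' = den r * den s' * b by exact: e.
apply/mkloc_eq; exists (denM r q); rewrite /= !scalerA.
have -> : den r * den q * (den s * den t) * b' =
  (den r * den s * b') * (den q * den t) by ring.
by rewrite -scalerA f scalerA e; congr (_ *: _); ring.
Qed.

Definition loc_ring := loc k^o.
HB.instance Definition _ := GRing.Zmodule.on loc_ring.

Fact loc_mulA : associative (@loc_scale k^o).
Proof.
move=> x y z.
have [m [s ->]] := locP x.
have [n [t ->]] := locP y.
have [o [r ->]] := locP z.
rewrite !loc_scaleE; apply/mkloc_eq; exists den1 => /=.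
rewrite /GRing.scale /=; ring.
Qed.

Fact loc_mulC : commutative (@loc_scale k^o).
Proof.
move=> x y.
have [m [s ->]] := locP x.
have [n [t ->]] := locP y.
rewrite !loc_scaleE; apply/mkloc_eq; exists den1 => /=.
rewrite /GRing.scale /=; ring.
Qed.

Fact loc_mul1 (M : lmodType k) :
  left_id (mkloc (1 : k^o) den1) (@loc_scale M).
Proof.
move=> x; have [m [s ->]] := locP x.
rewrite loc_scaleE scale1r; apply/mkloc_eq; exists den1 => /=.
by congr (_ *: _); ring.
Qed.

Fact loc_mulDl (M : lmodType k) (x : loc M) :
  {morph @loc_scale M ^~ x : a b / a + b}.
Proof.
move=> a b; have [a' [s ->]] := locP a.
have [b' [t ->]] := locP b.
have [m [r ->]] := locP x.
rewrite mklocD !loc_scaleE mklocD; apply/mkloc_eq; exists den1 => /=.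
rewrite !scalerDr !scalerA -scalerDl; congr (_ *: _).
rewrite /GRing.scale /=; ring.
Qed.

Fact loc_mulDr (M : lmodType k) : right_distributive (@loc_scale M) +%R.
Proof.
move=> a x y; have [a' [s ->]] := locP a.
have [m [t ->]] := locP x.
have [n [r ->]] := locP y.
rewrite mklocD !loc_scaleE mklocD; apply/mkloc_eq; exists den1 => /=.
by rewrite !scalerDr !scalerA; congr (_ *: _ + _ *: _); ring.
Qed.

Fact loc_rmulDl : left_distributive (@loc_scale k^o : loc_ring -> _ -> _) +%R.
Proof. by move=> a b x; exact: loc_mulDl. Qed.

HB.instance Definition _ := GRing.Zmodule_isComPzRing.Build loc_ring
  loc_mulA loc_mulC (@loc_mul1 k^o) loc_rmulDl.

Fact loc_scaleA (M : lmodType k) (a b : loc_ring) (x : loc M) :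
  loc_scale a (loc_scale b x) = loc_scale (a * b) x.
Proof.
have [a' [s ->]] := locP a.
have [b' [t ->]] := locP b.
have [m [r ->]] := locP x.
rewrite [_ * _]loc_scaleE !loc_scaleE; apply/mkloc_eq; exists den1 => /=.
by rewrite !scalerA; congr (_ *: _); rewrite /GRing.scale /=; ring.
Qed.

HB.instance Definition _ (M : lmodType k) :=
  GRing.Zmodule_isLmodule.Build loc_ring (loc M)
    (@loc_scaleA M) (@loc_mul1 M) (@loc_mulDr M) (@loc_mulDl M).

End Localization.

Section FgProjective.
Variables (k : comPzRingType) (M : lmodType k).

Definition free_of_rank (R : pzRingType) (V : lmodType R) (n : nat) : Prop :=
  exists b : 'I_n -> V,
    forall v, exists! c : 'I_n -> R, v = \sum_(i < n) c i *: b i.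

Definition finitely_generated : Prop :=
  exists (n : nat) (g : 'I_n -> M),
    forall m, exists c : 'I_n -> k, m = \sum_(i < n) c i *: g i.

Definition projective : Prop :=
  forall (A B : lmodType k) (q : {linear A -> B}) (f : {linear M -> B}),
    (forall b, exists a, q a = b) ->
    exists h : {linear M -> A}, forall m, q (h m) = f m.

Definition has_rank (n : nat) : Prop :=
  forall p : prime_ideal k, @free_of_rank (loc_ring p) (loc p M) n.

End FgProjective.

(** * The exterior algebra *)

Section Exterior.
Variables (k : comPzRingType) (M : lmodType k).

(* The exterior algebra is the k-algebra generated by the elements of M,
   subject to the linear relations of M and to m m = 0: formal expressions
   modulo the least congruence containing the axioms of a k-algebra and these
   relations. *)
Inductive ext_expr :=
  | ECst of k
  | EGen of M
  | EAdd of ext_expr & ext_expr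
  | EMul of ext_expr & ext_expr.

Inductive ext_rel : ext_expr -> ext_expr -> Prop :=
  | er_refl x : ext_rel x x
  | er_sym x y : ext_rel x y -> ext_rel y x
  | er_trans x y z : ext_rel x y -> ext_rel y z -> ext_rel x z
  | er_add x x' y y' :
      ext_rel x x' -> ext_rel y y' -> ext_rel (EAdd x y) (EAdd x' y')
  | er_mul x x' y y' :
      ext_rel x x' -> ext_rel y y' -> ext_rel (EMul x y) (EMul x' y')
  | er_addA x y z : ext_rel (EAdd x (EAdd y z)) (EAdd (EAdd x y) z)
  | er_addC x y : ext_rel (EAdd x y) (EAdd y x)
  | er_add0 x : ext_rel (EAdd (ECst 0) x) x
  | er_mul0 x : ext_rel (EMul (ECst 0) x) (ECst 0)
  | er_mulA x y z : ext_rel (EMul x (EMul y z)) (EMul (EMul x y) z)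
  | er_mul1 x : ext_rel (EMul (ECst 1) x) x
  | er_mulDl x y z :
      ext_rel (EMul (EAdd x y) z) (EAdd (EMul x z) (EMul y z))
  | er_mulDr x y z :
      ext_rel (EMul x (EAdd y z)) (EAdd (EMul x y) (EMul x z))
  | er_cstD a b : ext_rel (ECst (a + b)) (EAdd (ECst a) (ECst b))
  | er_cstM a b : ext_rel (ECst (a * b)) (EMul (ECst a) (ECst b))
  | er_cstC a x : ext_rel (EMul (ECst a) x) (EMul x (ECst a))
  | er_genD m n : ext_rel (EGen (m + n)) (EAdd (EGen m) (EGen n))
  | er_genZ a m : ext_rel (EGen (a *: m)) (EMul (ECst a) (EGen m))
  | er_sqr m : ext_rel (EMul (EGen m) (EGen m)) (ECst 0).

HB.instance Definition _ := gen_eqMixin ext_expr.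
HB.instance Definition _ := gen_choiceMixin ext_expr.

Definition ext_eq : rel ext_expr := fun x y => `[< ext_rel x y >].

Fact ext_eq_refl : reflexive ext_eq.
Proof. by move=> x; apply/asboolP; exact: er_refl. Qed.
Fact ext_eq_sym : symmetric ext_eq.
Proof. by move=> x y; apply/asboolP/asboolP; exact: er_sym. Qed.
Fact ext_eq_trans : transitive ext_eq.
Proof.
by move=> y x z /asboolP xy /asboolP yz; apply/asboolP; exact: er_trans yz.
Qed.

Canonical ext_equiv := EquivRel ext_eq ext_eq_refl ext_eq_sym ext_eq_trans.

Definition ext := {eq_quot ext_eq}.

HB.instance Definition _ := Choice.on ext.
HB.instance Definition _ := EqQuotient.on ext.

Definition ext_class (x : ext_expr) : ext := \pi_ext x.

Lemma ext_classP x y : ext_class x = ext_class y <-> ext_rel x y.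
Proof.
split=> [/eqP|h]; first by rewrite eqmodE => /asboolP.
by apply/eqP; rewrite eqmodE; apply/asboolP.
Qed.

Lemma ext_reprK (x : ext) : ext_class (repr x) = x.
Proof. exact: reprK. Qed.

Definition ext_add (x y : ext) := ext_class (EAdd (repr x) (repr y)).
Definition ext_mul (x y : ext) := ext_class (EMul (repr x) (repr y)).

Lemma ext_addE x y : ext_add (ext_class x) (ext_class y) = ext_class (EAdd x y).
Proof. by apply/ext_classP/er_add; apply/ext_classP; rewrite ext_reprK. Qed.
Lemma ext_mulE x y : ext_mul (ext_class x) (ext_class y) = ext_class (EMul x y).
Proof. by apply/ext_classP/er_mul; apply/ext_classP; rewrite ext_reprK. Qed.

Lemma ext_classK (x : ext) : exists t, x = ext_class t.
Proof. by exists (repr x); rewrite ext_reprK. Qed.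

Definition ext_opp (x : ext) := ext_mul (ext_class (ECst (- 1))) x.

Fact ext_addA : associative ext_add.
Proof.
move=> x y z; rewrite -(ext_reprK x) -(ext_reprK y) -(ext_reprK z) !ext_addE.
exact/ext_classP/er_addA.
Qed.
Fact ext_addC : commutative ext_add.
Proof.
move=> x y; rewrite -(ext_reprK x) -(ext_reprK y) !ext_addE.
exact/ext_classP/er_addC.
Qed.
Fact ext_add0 : left_id (ext_class (ECst 0)) ext_add.
Proof. move=> x; rewrite -(ext_reprK x) ext_addE; exact/ext_classP/er_add0. Qed.
Fact ext_mulA : associative ext_mul.
Proof.
move=> x y z; rewrite -(ext_reprK x) -(ext_reprK y) -(ext_reprK z) !ext_mulE.
exact/ext_classP/er_mulA.
Qed.
Fact ext_mul1 : left_id (ext_class (ECst 1)) ext_mul.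
Proof. move=> x; rewrite -(ext_reprK x) ext_mulE; exact/ext_classP/er_mul1. Qed.
Fact ext_cstC a x :
  ext_mul (ext_class (ECst a)) x = ext_mul x (ext_class (ECst a)).
Proof. rewrite -(ext_reprK x) !ext_mulE; exact/ext_classP/er_cstC. Qed.
Fact ext_mulr1 : right_id (ext_class (ECst 1)) ext_mul.
Proof. by move=> x; rewrite -ext_cstC ext_mul1. Qed.
Fact ext_mulDl : left_distributive ext_mul ext_add.
Proof.
move=> x y z; rewrite -(ext_reprK x) -(ext_reprK y) -(ext_reprK z).
rewrite !(ext_mulE, ext_addE); exact/ext_classP/er_mulDl.
Qed.
Fact ext_mulDr : right_distributive ext_mul ext_add.
Proof.
move=> x y z; rewrite -(ext_reprK x) -(ext_reprK y) -(ext_reprK z).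
rewrite !(ext_mulE, ext_addE); exact/ext_classP/er_mulDr.
Qed.
Fact ext_addN : left_inverse (ext_class (ECst 0)) ext_opp ext_add.
Proof.
move=> x; rewrite /ext_opp -[X in ext_add _ X]ext_mul1 -ext_mulDl ext_addE.
have /ext_classP <- := er_cstD (- 1) 1; rewrite addNr -(ext_reprK x) ext_mulE.
exact/ext_classP/er_mul0.
Qed.

HB.instance Definition _ :=
  GRing.isZmodule.Build ext ext_addA ext_addC ext_add0 ext_addN.
HB.instance Definition _ :=
  GRing.Zmodule_isPzRing.Build ext ext_mulA ext_mul1 ext_mulr1 ext_mulDl ext_mulDr.

Definition ext_cst (a : k) : ext := ext_class (ECst a).

Fact ext_cstD a b : ext_cst (a + b) = ext_cst a + ext_cst b.
Proof. by rewrite [RHS]ext_addE; exact/ext_classP/er_cstD. Qed.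
Fact ext_cstM a b : ext_cst (a * b) = ext_cst a * ext_cst b.
Proof. by rewrite [RHS]ext_mulE; exact/ext_classP/er_cstM. Qed.

Definition ext_scale (a : k) (x : ext) : ext := ext_cst a * x.

Fact ext_scaleA a b x : ext_scale a (ext_scale b x) = ext_scale (a * b) x.
Proof. by rewrite /ext_scale ext_cstM mulrA. Qed.
Fact ext_scale1 : left_id 1 ext_scale.
Proof. exact: mul1r. Qed.
Fact ext_scaleDr : right_distributive ext_scale +%R.
Proof. by move=> a x y; exact: mulrDr. Qed.
Fact ext_scaleDl x : {morph ext_scale^~ x : a b / a + b}.
Proof. by move=> a b; rewrite /ext_scale ext_cstD mulrDl. Qed.

HB.instance Definition _ := GRing.Zmodule_isLmodule.Build k ext
  ext_scaleA ext_scale1 ext_scaleDr ext_scaleDl.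

(* [ext] is not declared as an [algType], which would force 0 != 1 in it and so
   exclude the zero ring k. *)
Lemma ext_scaleAl a (x y : ext) : a *: (x * y) = (a *: x) * y.
Proof. exact: mulrA. Qed.

Lemma ext_scaleAr a (x y : ext) : a *: (x * y) = x * (a *: y).
Proof.
have cC z : ext_cst a * z = z * ext_cst a by exact: ext_cstC.
by rewrite -[LHS]/(ext_cst a * _) -[a *: y]/(ext_cst a * y) mulrA cC mulrA.
Qed.

Lemma ext_cstE a : ext_cst a = a *: (1 : ext).
Proof. by rewrite -[RHS]/(_ * 1) mulr1. Qed.

Fact ext_gen_linear : linear (fun m => ext_class (EGen m)).
Proof.
move=> a m n /=.
have -> : a *: ext_class (EGen m) = ext_class (EMul (ECst a) (EGen m)).
  exact: ext_mulE.
rewrite [RHS]ext_addE; apply/ext_classP.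
apply: er_trans (er_genD _ _) _; apply: er_add (er_refl _); exact: er_genZ.
Qed.

Definition ext_gen : hom M ext := mkhom ext_gen_linear.

Lemma ext_gen_sqr m : ext_gen m * ext_gen m = 0.
Proof. by rewrite [LHS]ext_mulE; exact/ext_classP/er_sqr. Qed.

Lemma ext_gen_anti m n : ext_gen m * ext_gen n + ext_gen n * ext_gen m = 0.
Proof.
have := ext_gen_sqr (m + n); rewrite linearD mulrDl !mulrDr !ext_gen_sqr.
by rewrite add0r addr0.
Qed.

Lemma ext_ind (P : ext -> Prop) :
    (forall a, P (a *: (1 : ext))) -> (forall m, P (ext_gen m)) ->
    (forall x y, P x -> P y -> P (x + y)) ->
    (forall x y, P x -> P y -> P (x * y)) -> forall x, P x.
Proof.
move=> Pc Pg PD PM x; rewrite -(ext_reprK x); elim: (repr x).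
- by move=> a; have := Pc a; rewrite -ext_cstE.
- exact: Pg.
- by move=> s Ps t Pt; rewrite -ext_addE; exact: PD.
- by move=> s Ps t Pt; rewrite -ext_mulE; exact: PM.
Qed.

End Exterior.

Section Lift.
Variables (k : comPzRingType) (M : lmodType k) (B : pzRingType).
Variables (c : k -> B) (f : M -> B).

Fixpoint lift_expr (t : ext_expr M) : B :=
  match t with
  | ECst a => c a
  | EGen m => f m
  | EAdd s t => lift_expr s + lift_expr t
  | EMul s t => lift_expr s * lift_expr t
  end.

Definition ext_lift (x : ext M) : B := lift_expr (repr x).

Hypotheses (c1 : c 1 = 1) (cD : {morph c : a b / a + b})
  (cM : {morph c : a b / a * b}) (cC : forall a x, c a * x = x * c a).
Hypotheses (fD : {morph f : m n / m + n}) (fZ : forall a m, f (a *: m) = c a * f m)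
  (f_sqr : forall m, f m * f m = 0).

Fact lift_c0 : c 0 = 0.
Proof. by apply: (addrI (c 0)); rewrite -cD !addr0. Qed.

Lemma lift_expr_rel s t : ext_rel s t -> lift_expr s = lift_expr t.
Proof.
elim=> //=; try by move=> *; congruence.
- by move=> x y z; rewrite addrA.
- by move=> x y; rewrite addrC.
- by move=> x; rewrite lift_c0 add0r.
- by move=> x; rewrite lift_c0 mul0r.
- by move=> x y z; rewrite mulrA.
- by move=> x; rewrite c1 mul1r.
- by move=> x y z; rewrite mulrDl.
- by move=> x y z; rewrite mulrDr.
- by move=> m; rewrite f_sqr lift_c0.
Qed.

Lemma ext_lift_class t : ext_lift (ext_class t) = lift_expr t.
Proof. by apply/lift_expr_rel/ext_classP; rewrite ext_reprK. Qed.

Lemma ext_lift_gen m : ext_lift (ext_gen M m) = f m.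
Proof. exact: ext_lift_class. Qed.

Lemma ext_liftD : {morph ext_lift : x y / x + y}.
Proof.
move=> x y; rewrite -(ext_reprK x) -(ext_reprK y) [X in ext_lift X]ext_addE.
by rewrite !ext_lift_class.
Qed.

Lemma ext_liftM : {morph ext_lift : x y / x * y}.
Proof.
move=> x y; rewrite -(ext_reprK x) -(ext_reprK y) [X in ext_lift X]ext_mulE.
by rewrite !ext_lift_class.
Qed.

Lemma ext_lift1 : ext_lift 1 = 1.
Proof. by rewrite [LHS]ext_lift_class /= c1. Qed.

Lemma ext_liftZ a x : ext_lift (a *: x) = c a * ext_lift x.
Proof. by rewrite [LHS]ext_liftM [X in X * _]ext_lift_class. Qed.

Lemma ext_lift_unique (g : ext M -> B) :
    g 1 = 1 -> {morph g : x y / x + y} -> {morph g : x y / x * y} ->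
    (forall a x, g (a *: x) = c a * g x) -> (forall m, g (ext_gen M m) = f m) ->
  g =1 ext_lift.
Proof.
move=> g1 gD gM gZ gf; apply: ext_ind.
- by move=> a; rewrite gZ g1 ext_liftZ ext_lift1.
- by move=> m; rewrite gf ext_lift_gen.
- by move=> x y ex ey; rewrite gD ext_liftD ex ey.
- by move=> x y ex ey; rewrite gM ext_liftM ex ey.
Qed.

End Lift.

Section Functor.
Variables (k : comPzRingType) (M N : lmodType k) (g : hom M N).

Fact ext_cst1 : ext_cst N 1 = 1. Proof. by []. Qed.

Fact ext_map_sqr m : ext_gen N (g m) * ext_gen N (g m) = 0.
Proof. exact: ext_gen_sqr. Qed.

Fact ext_mapD : {morph (ext_gen N \o g) : m n / m + n}.
Proof.
move=> m n.
exact: etrans (congr1 (ext_gen N) (linearD g m n)) (linearD (ext_gen N) _ _).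
Qed.

Fact ext_mapZ a m : (ext_gen N \o g) (a *: m) = ext_cst N a * (ext_gen N \o g) m.
Proof.
exact: etrans (congr1 (ext_gen N) (linearZZ g a m)) (linearZZ (ext_gen N) _ _).
Qed.

Definition ext_map_fun : ext M -> ext N := ext_lift (ext_cst N) (ext_gen N \o g).

Fact ext_map_linear : linear ext_map_fun.
Proof.
have hD := ext_liftD ext_cst1 (@ext_cstD _ N) (@ext_cstM _ N) (@ext_cstC _ N)
  ext_mapD ext_mapZ ext_map_sqr.
have hZ := ext_liftZ ext_cst1 (@ext_cstD _ N) (@ext_cstM _ N) (@ext_cstC _ N)
  ext_mapD ext_mapZ ext_map_sqr.
by move=> a x y; rewrite /ext_map_fun hD hZ.
Qed.

Definition ext_map : hom (ext M) (ext N) := mkhom ext_map_linear.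

Lemma ext_map_gen m : ext_map (ext_gen M m) = ext_gen N (g m).
Proof.
exact: (ext_lift_gen ext_cst1 (@ext_cstD _ N) (@ext_cstM _ N) (@ext_cstC _ N)
  ext_mapD ext_mapZ ext_map_sqr).
Qed.

Lemma ext_mapM : {morph ext_map : x y / x * y}.
Proof.
exact: (ext_liftM ext_cst1 (@ext_cstD _ N) (@ext_cstM _ N) (@ext_cstC _ N)
  ext_mapD ext_mapZ ext_map_sqr).
Qed.

Lemma ext_map1 : ext_map 1 = 1.
Proof.
exact: (ext_lift1 ext_cst1 (@ext_cstD _ N) (@ext_cstM _ N) (@ext_cstC _ N)
  ext_mapD ext_mapZ ext_map_sqr).
Qed.

End Functor.

Section DegreeZeroOne.
Variables (k : comPzRingType) (M : lmodType k).

(* The components of degree 0 and 1, through which Lambda_0 M is identified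
   with k and Lambda_1 M with M. *)

Let z (m : M) : k^o := 0.

Fact deg0_sideD : {morph (z : M -> k) : m n / m + n}.
Proof. by move=> m n; rewrite /z addr0. Qed.
Fact deg0_sideZ a m : (z : M -> k) (a *: m) = a * z m.
Proof. by rewrite /z mulr0. Qed.
Fact deg0_side_sqr m : (z m : k) * (z m : k) = 0.
Proof. by rewrite /z mulr0. Qed.

Definition deg0_fun : ext M -> k^o := ext_lift (fun a : k => a) (fun _ : M => 0).

Let hZ := @ext_liftZ k M k (fun a => a) z (erefl _) (fun _ _ => erefl _)
  (fun _ _ => erefl _) (@mulrC _) deg0_sideD deg0_sideZ deg0_side_sqr.
Let hD := @ext_liftD k M k (fun a => a) z (erefl _) (fun _ _ => erefl _)
  (fun _ _ => erefl _) (@mulrC _) deg0_sideD deg0_sideZ deg0_side_sqr.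

Fact deg0_linear : linear deg0_fun.
Proof. by move=> a x y; rewrite [LHS]hD [X in X + _]hZ. Qed.

Definition deg0 : hom (ext M) k^o := mkhom deg0_linear.

Lemma deg0_1 : deg0 1 = 1.
Proof.
exact: (@ext_lift1 k M k (fun a => a) z (erefl _) (fun _ _ => erefl _)
  (fun _ _ => erefl _) (@mulrC _) deg0_sideD deg0_sideZ deg0_side_sqr).
Qed.

Lemma deg0M (x y : ext M) : deg0 (x * y) = (deg0 x : k) * (deg0 y : k).
Proof.
exact: (@ext_liftM k M k (fun a => a) z (erefl _) (fun _ _ => erefl _)
  (fun _ _ => erefl _) (@mulrC _) deg0_sideD deg0_sideZ deg0_side_sqr).
Qed.

Lemma deg0_gen m : deg0 (ext_gen M m) = 0.
Proof.
exact: (@ext_lift_gen k M k (fun a => a) z (erefl _) (fun _ _ => erefl _)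
  (fun _ _ => erefl _) (@mulrC _) deg0_sideD deg0_sideZ deg0_side_sqr).
Qed.

Lemma deg0_cst a : deg0 (ext_cst M a) = a.
Proof.
rewrite ext_cstE; apply: etrans (linearZZ deg0 a 1) _.
exact: etrans (congr1 (fun x : k => a * x) deg0_1) (mulr1 a).
Qed.

Fixpoint deg1_expr (t : ext_expr M) : M :=
  match t with
  | ECst _ => 0
  | EGen m => m
  | EAdd s t => deg1_expr s + deg1_expr t
  | EMul s t => (deg0 (ext_class s) : k) *: deg1_expr t
              + (deg0 (ext_class t) : k) *: deg1_expr s
  end.

Lemma deg1_expr_rel s t : ext_rel s t -> deg1_expr s = deg1_expr t.
Proof.
have cA s1 s2 : ext_class (EAdd s1 s2) = ext_class s1 + ext_class s2 :> ext M.
  by rewrite [RHS]ext_addE.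
have cM s1 s2 : ext_class (EMul s1 s2) = ext_class s1 * ext_class s2 :> ext M.
  by rewrite [RHS]ext_mulE.
have c0 a : deg0 (ext_class (ECst M a)) = a by exact: deg0_cst.
have d0D (s1 s2 : ext M) : deg0 (s1 + s2) = (deg0 s1 : k) + (deg0 s2 : k).
  exact: linearD.
have g0 m : deg0 (ext_class (EGen m)) = 0 by exact: deg0_gen.
elim=> //=; try by move=> *; congruence.
- move=> x x' y y' /ext_classP ex -> /ext_classP ey ->.
  by rewrite ex ey.
- by move=> x y z'; rewrite addrA.
- by move=> x y; rewrite addrC.
- by move=> x; rewrite add0r.
- by move=> x; rewrite c0 scale0r scaler0 addr0.
- move=> x y z'; rewrite !cM !deg0M !scalerDr !scalerA addrA.
  by congr (_ *: _ + _ *: _ + _ *: _); ring.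
- by move=> x; rewrite c0 scale1r scaler0 addr0.
- move=> x y z'; rewrite cA d0D scalerDl !scalerDr.
  by rewrite addrACA.
- move=> x y z'; rewrite cA d0D scalerDl !scalerDr.
  by rewrite addrACA.
- by move=> *; rewrite addr0.
- by move=> *; rewrite !scaler0 addr0.
- by move=> *; rewrite addrC.
- by move=> a m; rewrite c0 scaler0 addr0.
- by move=> m; rewrite g0 !scale0r addr0.
Qed.

Definition deg1_fun (x : ext M) : M := deg1_expr (repr x).

Lemma deg1_class t : deg1_fun (ext_class t) = deg1_expr t.
Proof. by apply/deg1_expr_rel/ext_classP; rewrite ext_reprK. Qed.

Lemma deg1_funM x y :
  deg1_fun (x * y) = (deg0 x : k) *: deg1_fun y + (deg0 y : k) *: deg1_fun x.
Proof.
rewrite -(ext_reprK x) -(ext_reprK y) [X in deg1_fun X]ext_mulE.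
by rewrite !deg1_class.
Qed.

Fact deg1_linear : linear deg1_fun.
Proof.
move=> a x y; have -> : a *: x + y = ext_cst M a * x + y by [].
have -> : a *: deg1_fun x = deg1_fun (ext_cst M a * x).
  by rewrite deg1_funM deg0_cst [deg1_fun (ext_cst _ _)]deg1_class scaler0 addr0.
move: (ext_cst M a * x) => {}x.
rewrite -(ext_reprK x) -(ext_reprK y) [X in deg1_fun X]ext_addE.
by rewrite !deg1_class.
Qed.

Definition deg1 : hom (ext M) M := mkhom deg1_linear.

Lemma deg1_gen m : deg1 (ext_gen M m) = m.
Proof. exact: deg1_class. Qed.

Lemma deg1M x y :
  deg1 (x * y) = (deg0 x : k) *: deg1 y + (deg0 y : k) *: deg1 x.
Proof. exact: deg1_funM. Qed.

End DegreeZeroOne.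

Section TwistedDerivation.
Variables (k : comPzRingType) (M : lmodType k).
Variables (sigma : ext M -> ext M) (f : M -> ext M).

Fixpoint tder_expr (t : ext_expr M) : ext M :=
  match t with
  | ECst _ => 0
  | EGen m => f m
  | EAdd s t => tder_expr s + tder_expr t
  | EMul s t => tder_expr s * ext_class t + sigma (ext_class s) * tder_expr t
  end.

(* The map d with d(xy) = d(x)y + sigma(x)d(y) extending f. *)
Definition tder_fun (x : ext M) : ext M := tder_expr (repr x).

Hypotheses (sigmaD : {morph sigma : x y / x + y})
  (sigmaM : {morph sigma : x y / x * y})
  (sigma_cst : forall a, sigma (ext_cst M a) = ext_cst M a).
Hypotheses (f_linear : linear f)
  (f_sqr : forall m, f m * ext_gen M m + sigma (ext_gen M m) * f m = 0).

Lemma tder_expr_rel s t : ext_rel s t -> tder_expr s = tder_expr t.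
Proof.
have cA s1 s2 : ext_class (EAdd s1 s2) = ext_class s1 + ext_class s2 :> ext M.
  by rewrite [RHS]ext_addE.
have cM s1 s2 : ext_class (EMul s1 s2) = ext_class s1 * ext_class s2 :> ext M.
  by rewrite [RHS]ext_mulE.
have cC a (x : ext M) : ext_cst M a * x = x * ext_cst M a by exact: ext_cstC.
have sc a : sigma (ext_class (ECst M a)) = ext_cst M a := sigma_cst a.
have c0 : ext_cst M 0 = 0 by [].
have c1 : ext_cst M 1 = 1 by [].
elim=> //=; try by move=> *; congruence.
- move=> x x' y y' /ext_classP ex -> /ext_classP ey ->.
  by rewrite ex ey.
- by move=> x y z; rewrite addrA.
- by move=> x y; rewrite addrC.
- by move=> x; rewrite add0r.
- by move=> x; rewrite sc c0 !mul0r addr0.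
- move=> x y z; rewrite !cM sigmaM !mulrDr mulrDl !mulrA addrA.
  by [].
- by move=> x; rewrite sc c1 mul0r mul1r add0r.
- move=> x y z; rewrite cA sigmaD !mulrDl.
  by rewrite addrACA.
- move=> x y z; rewrite cA !mulrDr.
  by rewrite addrACA.
- by move=> *; rewrite addr0.
- by move=> *; rewrite mul0r mulr0 addr0.
- by move=> a x; rewrite sc mul0r mulr0 add0r addr0 cC.
- move=> m n; have := f_linear 1 m n; by rewrite !scale1r.
- move=> a m; rewrite sc mul0r add0r.
  have := f_linear a m 0; rewrite !addr0 => ->.
  have := f_linear 1 0 0; rewrite !scale1r addr0 => /(congr1 (+%R (- f 0))).
  by rewrite addrA addNr add0r => <-; rewrite addr0.
Qed.

Lemma tder_class t : tder_fun (ext_class t) = tder_expr t.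
Proof. by apply/tder_expr_rel/ext_classP; rewrite ext_reprK. Qed.

Lemma tder_funM x y : tder_fun (x * y) = tder_fun x * y + sigma x * tder_fun y.
Proof.
rewrite -(ext_reprK x) -(ext_reprK y) [X in tder_fun X]ext_mulE.
by rewrite !tder_class.
Qed.

Lemma tder_fun_gen m : tder_fun (ext_gen M m) = f m.
Proof. exact: tder_class. Qed.

Lemma tder_linear : linear tder_fun.
Proof.
move=> a x y; have -> : a *: x + y = ext_cst M a * x + y by [].
have -> : a *: tder_fun x = tder_fun (ext_cst M a * x).
  by rewrite tder_funM sigma_cst [tder_fun (ext_cst _ _)]tder_class mul0r add0r.
move: (ext_cst M a * x) => {}x.
rewrite -(ext_reprK x) -(ext_reprK y) [X in tder_fun X]ext_addE.
by rewrite !tder_class.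
Qed.

End TwistedDerivation.

Section Derivations.
Variables (k : comPzRingType) (M : lmodType k).

Section Der.
Variable alpha : hom M M.

Definition der_gen (m : M) : ext M := ext_gen M (alpha m).

Fact der_gen_linear : linear der_gen.
Proof.
move=> a m n; rewrite /der_gen.
exact: etrans (congr1 (ext_gen M) (homfP alpha a m n)) (homfP (ext_gen M) _ _ _).
Qed.

Fact der_gen_sqr m : der_gen m * ext_gen M m + ext_gen M m * der_gen m = 0.
Proof. exact: ext_gen_anti. Qed.

Fact der_linear : linear (tder_fun id der_gen).
Proof. by apply: tder_linear => //; [exact: der_gen_linear|exact: der_gen_sqr]. Qed.

(* D_alpha *)
Definition der : hom (ext M) (ext M) := mkhom der_linear.

Lemma der_gen_eq m : der (ext_gen M m) = ext_gen M (alpha m).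
Proof.
by apply: tder_fun_gen => //; [exact: der_gen_linear|exact: der_gen_sqr].
Qed.

Lemma derM x y : der (x * y) = der x * y + x * der y.
Proof.
by apply: tder_funM => //; [exact: der_gen_linear|exact: der_gen_sqr].
Qed.

Lemma der1 : der 1 = 0.
Proof.
have := derM 1 1; rewrite !mulr1 mul1r => /(congr1 (+%R (- der 1))).
by rewrite addrA addNr add0r.
Qed.

End Der.

Lemma der_linear_arg (a : k) (alpha alpha' : hom M M) :
  der (a *: alpha + alpha') = a *: der alpha + der alpha'.
Proof.
apply: homP => x; rewrite homDE homZE; elim/ext_ind: x => [b|m|y z ey ez|y z ey ez].
- by rewrite !homfZ !der1 !scaler0 addr0.
- by rewrite !der_gen_eq; exact: (homfP (ext_gen M)).
- by rewrite !(homfD (der _)) ey ez scalerDr addrACA.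
- by rewrite !derM ey ez mulrDl mulrDr scalerDr ext_scaleAl ext_scaleAr addrACA.
Qed.

Fact opp_id_linear : linear (fun m : M => - m).
Proof. by move=> a x y; rewrite scalerN opprD. Qed.

(* The automorphism equal to (-1)^i on Lambda_i M. *)
Definition ext_sign : hom (ext M) (ext M) := ext_map (mkhom opp_id_linear).

Lemma ext_sign_gen m : ext_sign (ext_gen M m) = - ext_gen M m.
Proof. by rewrite ext_map_gen; exact: homfN. Qed.

Lemma ext_signM : {morph ext_sign : x y / x * y}.
Proof. exact: ext_mapM. Qed.

Lemma ext_sign1 : ext_sign 1 = 1.
Proof. exact: ext_map1. Qed.

Lemma ext_signD : {morph ext_sign : x y / x + y}.
Proof. exact: homfD. Qed.

Lemma ext_sign_cst a : ext_sign (ext_cst M a) = ext_cst M a.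
Proof.
by rewrite ext_cstE; apply: etrans (homfZ ext_sign a 1) _; rewrite ext_sign1.
Qed.

Section AntiDer.
Variable phi : dual M.

Definition antider_gen (m : M) : ext M := ext_cst M ((phi : hom M k^o) m).

Fact antider_gen_linear : linear antider_gen.
Proof.
move=> a m n; rewrite /antider_gen.
rewrite (homfP (phi : hom M k^o)); apply: etrans (ext_cstD _ _ _) _.
by congr (_ + _); exact: ext_cstM.
Qed.

Fact antider_gen_sqr m :
  antider_gen m * ext_gen M m + ext_sign (ext_gen M m) * antider_gen m = 0.
Proof.
rewrite ext_sign_gen mulNr; apply/eqP; rewrite subr_eq0; apply/eqP.
exact: ext_cstC.
Qed.

Fact antider_linear : linear (tder_fun ext_sign antider_gen).
Proof.
apply: tder_linear; [exact: ext_signD|exact: ext_signM|exact: ext_sign_cst|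
  exact: antider_gen_linear|exact: antider_gen_sqr].
Qed.

(* Delta_phi *)
Definition antider : hom (ext M) (ext M) := mkhom antider_linear.

Lemma antider_gen_eq m : antider (ext_gen M m) = ext_cst M ((phi : hom M k^o) m).
Proof.
apply: tder_fun_gen; [exact: ext_signD|exact: ext_signM|exact: ext_sign_cst|
  exact: antider_gen_linear|exact: antider_gen_sqr].
Qed.

Lemma antiderM x y : antider (x * y) = antider x * y + ext_sign x * antider y.
Proof.
apply: tder_funM; [exact: ext_signD|exact: ext_signM|exact: ext_sign_cst|
  exact: antider_gen_linear|exact: antider_gen_sqr].
Qed.

Lemma antider1 : antider 1 = 0.
Proof.
have := antiderM 1 1; rewrite ext_sign1 !mulr1 mul1r => /(congr1 (+%R (- antider 1))).
by rewrite addrA addNr add0r.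
Qed.

Lemma antider_cst a : antider (ext_cst M a) = 0.
Proof.
rewrite ext_cstE; apply: etrans (homfZ antider a 1) _.
by rewrite antider1 scaler0.
Qed.

Lemma antider_sign x : antider (ext_sign x) = - ext_sign (antider x).
Proof.
elim/ext_ind: x.
- move=> a; rewrite -ext_cstE ext_sign_cst antider_cst.
  by rewrite (homf0 ext_sign) oppr0.
- move=> m; rewrite ext_sign_gen (homfN antider) antider_gen_eq.
  by rewrite ext_sign_cst.
- by move=> x y ex ey; rewrite !(homfD ext_sign, homfD antider) ex ey opprD.
- move=> x y ex ey; rewrite ext_signM !antiderM ex ey (homfD ext_sign).
  by rewrite !ext_signM opprD mulNr mulrN.
Qed.

Lemma antider_sqr x : antider (antider x) = 0.
Proof.
elim/ext_ind: x.
- by move=> a; rewrite -ext_cstE antider_cst (homf0 antider).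
- by move=> m; rewrite antider_gen_eq antider_cst.
- by move=> x y ex ey; rewrite !(homfD antider) ex ey addr0.
- move=> x y ex ey; rewrite antiderM (homfD antider) !antiderM ex ey.
  by rewrite mul0r mulr0 add0r addr0 antider_sign mulNr addrN.
Qed.

End AntiDer.

Lemma antider_linear_arg (a : k) (phi psi : dual M) :
  antider (a *: phi + psi) = a *: antider phi + antider psi.
Proof.
apply: homP => x; rewrite homDE homZE; elim/ext_ind: x.
- move=> b; rewrite -ext_cstE !antider_cst; by rewrite scaler0 addr0.
- move=> m; rewrite !antider_gen_eq.
  exact: etrans (ext_cstD _ _ _) (congr1 (+%R^~ _) (ext_cstM _ _ _)).
- move=> x y ex ey; rewrite 3!(homfD (antider _)) ex ey scalerDr.
  by rewrite addrACA.
- move=> x y ex ey; rewrite !antiderM ex ey mulrDl mulrDr scalerDr.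
  by rewrite ext_scaleAl ext_scaleAr addrACA.
Qed.

Definition end_scalar (a : k) : hom (ext M) (ext M) :=
  a *: hom_id (ext M).

Fact end_scalar1 : end_scalar 1 = 1. Proof. exact: scale1r. Qed.
Fact end_scalarD : {morph end_scalar : a b / a + b}.
Proof. by move=> a b; exact: scalerDl. Qed.
Fact end_scalarM : {morph end_scalar : a b / a * b}.
Proof. by move=> a b; apply: homP => x; exact/esym/scalerA. Qed.
Fact end_scalarC a f : end_scalar a * f = f * end_scalar a.
Proof. by apply: homP => x; exact/esym/homfZ. Qed.
Fact antiderD : {morph antider : phi psi / phi + psi}.
Proof.
by move=> phi psi; have := antider_linear_arg 1 phi psi; rewrite !scale1r.
Qed.
Fact antiderZ a phi : antider (a *: phi) = end_scalar a * antider phi.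
Proof.
have := antider_linear_arg a phi 0; have := antider_linear_arg 1 0 0.
rewrite !scale1r !addr0 => /(congr1 (+%R (- antider 0))).
rewrite addrA addNr add0r => <-; rewrite addr0 => ->.
by apply: homP => x; rewrite homME homZE.
Qed.
Fact antider_sqr0 phi : antider phi * antider phi = 0.
Proof. by apply: homP => x; exact: antider_sqr. Qed.

(* xi |-> Delta_xi, the algebra homomorphism extending phi |-> Delta_phi;
   [lact xi x] is xi . x *)
Definition lact : ext (dual M) -> hom (ext M) (ext M) :=
  ext_lift end_scalar antider.

Lemma lactD : {morph lact : xi psi / xi + psi}.
Proof.
exact: (ext_liftD end_scalar1 end_scalarD end_scalarM end_scalarC
  antiderD antiderZ antider_sqr0).
Qed.

Lemma lactM (xi psi : ext (dual M)) : lact (xi * psi) = lact xi * lact psi.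
Proof.
exact: (ext_liftM end_scalar1 end_scalarD end_scalarM end_scalarC
  antiderD antiderZ antider_sqr0).
Qed.

Lemma lact1 : lact 1 = 1.
Proof.
exact: (ext_lift1 end_scalar1 end_scalarD end_scalarM end_scalarC
  antiderD antiderZ antider_sqr0).
Qed.

Lemma lactZ a xi : lact (a *: xi) = a *: lact xi.
Proof.
have := ext_liftZ end_scalar1 end_scalarD end_scalarM end_scalarC
  antiderD antiderZ antider_sqr0 a xi.
by rewrite -/lact => ->; apply: homP => x; rewrite homME homZE.
Qed.

Lemma lact_gen phi : lact (ext_gen (dual M) phi) = antider phi.
Proof.
exact: (ext_lift_gen end_scalar1 end_scalarD end_scalarM end_scalarC
  antiderD antiderZ antider_sqr0).
Qed.

End Derivations.

(* [ract x xi] is x . xi: the action of Lambda(M^** ) on Lambda(M^* ), restricted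
   to Lambda(M) along M -> M^**. *)
Definition ract (k : comPzRingType) (M : lmodType k) (x : ext M) :
    hom (ext (dual M)) (ext (dual M)) :=
  lact (ext_map (evdual M) x).

Lemma ract_linear (k : comPzRingType) (M : lmodType k) (a : k) (x y : ext M) :
  ract (a *: x + y) = a *: ract x + ract y.
Proof.
by rewrite /ract (homfP (ext_map (evdual M))) lactD lactZ.
Qed.

(** * Graded components *)

Section Grading.
Variables (k : comPzRingType) (M : lmodType k) (i : nat).

(* Lambda_i M is spanned by the products of i elements of M. *)
Definition homog : {pred ext M} := fun x =>
  `[< exists s : seq (k * ('I_i -> M)),
        x = \sum_(p <- s) p.1 *: \prod_(j < i) ext_gen M (p.2 j) >].

Fact homog_closed : GRing.subsemimod_closed homog.
Proof.
split; first split.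
- by apply: asboolT; exists [::]; rewrite big_nil.
- move=> x y /asboolP[s ->] /asboolP[t ->]; apply: asboolT.
  by exists (s ++ t); rewrite big_cat.
- move=> a x /asboolP[s ->]; apply: asboolT.
  exists [seq (a * p.1, p.2) | p <- s]; rewrite big_map scaler_sumr.
  by apply: eq_bigr => p _; rewrite scalerA.
Qed.

HB.instance Definition _ := GRing.isSubSemiModClosed.Build k (ext M) homog homog_closed.

Record gr := Gr { gr_val :> ext M; gr_homog : gr_val \in homog }.

HB.instance Definition _ := [isSub for gr_val].
HB.instance Definition _ := [Choice of gr by <:].
HB.instance Definition _ :=
  GRing.SubChoice_isSubLmodule.Build k (ext M) homog gr homog_closed.

Lemma grD (x y : gr) : gr_val (x + y) = gr_val x + gr_val y. Proof. by []. Qed.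
Lemma grZ a (x : gr) : gr_val (a *: x) = a *: gr_val x. Proof. by []. Qed.

Lemma homog0 : 0 \in homog.
Proof. exact: (valP (0 : gr)). Qed.
Lemma homogD x y : x \in homog -> y \in homog -> x + y \in homog.
Proof. by move=> hx hy; exact: (valP (Gr hx + Gr hy)). Qed.
Lemma homogZ a x : x \in homog -> a *: x \in homog.
Proof. by move=> hx; exact: (valP (a *: Gr hx)). Qed.

Lemma homog_prod (v : 'I_i -> M) : \prod_(j < i) ext_gen M (v j) \in homog.
Proof. by apply: asboolT; exists [:: (1, v)]; rewrite big_seq1 scale1r. Qed.

Lemma homog_ind (P : ext M -> Prop) :
    P 0 -> (forall a x y, P x -> P y -> P (a *: x + y)) ->
    (forall v : 'I_i -> M, P (\prod_(j < i) ext_gen M (v j))) ->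
  forall x, x \in homog -> P x.
Proof.
move=> P0 PZ Pp x /asboolP[s ->]; elim: s => [|p s IH]; first by rewrite big_nil.
by rewrite big_cons; exact: PZ.
Qed.

End Grading.

Arguments homog {k} M i.

Section Restriction.
Variables (k : comPzRingType) (M : lmodType k).

Lemma homogM i j (x y : ext M) :
  x \in homog M i -> y \in homog M j -> x * y \in homog M (i + j).
Proof.
move=> hx hy; elim/homog_ind: hx.
- by rewrite mul0r homog0.
- move=> a x1 x2 h1 h2; rewrite mulrDl -ext_scaleAl.
  by apply: homogD h2; exact: homogZ.
move=> v; elim/homog_ind: hy.
- by rewrite mulr0 homog0.
- move=> a x1 x2 h1 h2; rewrite mulrDr -ext_scaleAr.
  by apply: homogD h2; exact: homogZ.
move=> w; pose g (l : 'I_(i + j)) :=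
  match fintype.split l with inl l1 => v l1 | inr l2 => w l2 end.
have gl l : g (lshift j l) = v l by rewrite /g (unsplitK (inl l)).
have gr l : g (rshift i l) = w l by rewrite /g (unsplitK (inr l)).
have := homog_prod g; rewrite big_split_ord /=.
under eq_bigr do rewrite gl; under [X in _ * X]eq_bigr do rewrite gr.
by [].
Qed.

Lemma homog_gen m : ext_gen M m \in homog M 1.
Proof. by have := homog_prod (fun _ : 'I_1 => m); rewrite big_ord1. Qed.

Lemma ext_sign_homog i x : x \in homog M i -> ext_sign M x = (-1) ^+ i * x.
Proof.
elim/homog_ind => [|a y z ey ez|v]; first by rewrite (homf0 (ext_sign M)) mulr0.
  by rewrite (homfP (ext_sign M)) ey ez mulrDr ext_scaleAr.
elim: i v => [|i IH] v; first by rewrite big_ord0 ext_sign1 mulr1.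
rewrite big_ord_recl ext_signM IH ext_sign_gen exprS mulN1r !mulNr.
congr (- _); rewrite -signr_odd.
by case: (odd i); rewrite ?expr0 ?expr1 ?mul1r ?mulN1r ?mulrN.
Qed.

Lemma antider_homogM (phi : dual M) i x y : x \in homog M i ->
  antider phi (x * y) = antider phi x * y + (-1) ^+ i * x * antider phi y.
Proof. by move=> hx; rewrite antiderM (ext_sign_homog hx). Qed.

Lemma der_homog (alpha : hom M M) i x :
  x \in homog M i -> der alpha x \in homog M i.
Proof.
elim/homog_ind => [|a y z hy hz|v]; first by rewrite (homf0 (der alpha)) homog0.
  by rewrite (homfP (der alpha)); apply: homogD hz; exact: homogZ.
elim: i v => [|i IH] v.
  by rewrite big_ord0 der1 homog0.
rewrite big_ord_recl derM der_gen_eq; apply: homogD.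
  by apply: (@homogM 1 i); [exact: homog_gen|exact: homog_prod].
by apply: (@homogM 1 i); [exact: homog_gen|exact: IH].
Qed.

Definition der_gr_fun (alpha : hom M M) i (x : gr M i) : gr M i :=
  Gr (der_homog alpha (gr_homog x)).

Fact der_gr_linear alpha i : linear (@der_gr_fun alpha i).
Proof. by move=> a x y; apply/val_inj; exact: (homfP (der alpha)). Qed.

(* rho_M *)
Definition rho (alpha : hom M M) : hom (gr M 3) (gr M 3) :=
  mkhom (@der_gr_linear alpha 3).

Lemma rhoE alpha (x : gr M 3) : gr_val (rho alpha x) = der alpha (gr_val x). Proof. by []. Qed.

Definition gr_pair_fun i (xi : gr (dual M) i) (x : gr M i) : k^o :=
  deg0 M (lact (gr_val xi) (gr_val x)).

Fact gr_pair_linear i xi : linear (@gr_pair_fun i xi).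
Proof.
move=> a x y; rewrite /gr_pair_fun grD grZ (homfP (lact xi)).
exact: homfP.
Qed.

(* xi |-> (x |-> xi . x), an isomorphism from Lambda_i(M^* ) to (Lambda_i M)^*
   when M is finitely generated projective *)
Definition gr_pair i (xi : gr (dual M) i) : dual (gr M i) :=
  mkhom (@gr_pair_linear i xi).

Definition e_fun (x : ext M) (xi : ext (dual M)) (m : M) : M :=
  deg1 M (lact (ract (ext_gen M m) xi) x).

Fact e_linear x xi : linear (e_fun x xi).
Proof.
move=> a m n; rewrite /e_fun (homfP (ext_gen M)) ract_linear homDE homZE.
by rewrite lactD lactZ homDE homZE (homfP (deg1 M)).
Qed.

(* e(x, xi)(m) = (m . xi) . x; for x and xi of the same degree the right-hand
   side is of degree 1. *)
Definition e_map (x : ext M) (xi : ext (dual M)) : hom M M := mkhom (e_linear x xi).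

Definition delta (x : gr M 3) (xi : gr (dual M) 3) : hom (gr M 3) (gr M 3) :=
  rho (e_map (gr_val x) (gr_val xi)) - (deg0 (dual M) (ract (gr_val x) (gr_val xi)) : k) *: hom_id (gr M 3).

End Restriction.

(** * The Lie algebra *)

Section SLTilde.
Variables (k : comPzRingType) (M : lmodType k).
Implicit Type beta : hom (gr M 3) (gr M 3).

Definition in_gl beta : Prop :=
  exists (alpha : hom M M) (c : k), beta = rho alpha + c *: hom_id (gr M 3).

Definition in_ext3 (x : ext M) : Prop :=
  exists (x0 : gr M 0) (x3 : gr M 3) (x6 : gr M 6) (x9 : gr M 9),
    x = gr_val x0 + gr_val x3 + gr_val x6 + gr_val x9.

(* d restricts to a derivation of the subalgebra of the elements satisfying
   [in_ext3] and extends beta. The values of d elsewhere are irrelevant; on the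
   subalgebra it is determined by beta since Lambda_3 M generates the subalgebra. *)
Definition extends_to_der beta (d : ext M -> ext M) : Prop :=
  [/\ forall x, in_ext3 x -> in_ext3 (d x),
      forall (a : k) x y, in_ext3 x -> in_ext3 y -> d (a *: x + y) = a *: d x + d y,
      forall x y, in_ext3 x -> in_ext3 y -> d (x * y) = d x * y + x * d y
    & forall x : gr M 3, d (gr_val x) = gr_val (beta x)].

Lemma in_ext3_gr i (x : gr M i) : i \in [:: 0; 3; 6; 9]%N -> in_ext3 (gr_val x).
Proof.
rewrite !inE => /or4P[] /eqP ei; subst i.
- by exists x, 0, 0, 0; rewrite !addr0.
- by exists 0, x, 0, 0; rewrite add0r !addr0.
- by exists 0, 0, x, 0; rewrite !add0r addr0.
- by exists 0, 0, 0, x; rewrite !add0r.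
Qed.

Fact in_ext3_linear a x y : in_ext3 x -> in_ext3 y -> in_ext3 (a *: x + y).
Proof.
move=> [x0 [x3 [x6 [x9 ->]]]] [y0 [y3 [y6 [y9 ->]]]].
exists (a *: x0 + y0), (a *: x3 + y3), (a *: x6 + y6), (a *: x9 + y9).
rewrite !grD !grZ !scalerDr.
by rewrite addrACA; congr (_ + _); rewrite addrACA; congr (_ + _); rewrite addrACA.
Qed.

Lemma extends_to_der_unique beta d d' x :
  extends_to_der beta d -> extends_to_der beta d' -> in_ext3 x -> d x = d' x.
Proof.
move=> [_ dL dM db] [_ dL' dM' db'].
pose P (y : ext M) := in_ext3 y /\ d y = d' y.
have P1 : P 1.
  have h1 : in_ext3 (1 : ext M).
    have h : 1 \in homog M 0.
      by have := homog_prod (fun _ : 'I_0 => 0 : M); rewrite big_ord0.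
    exact: (in_ext3_gr (Gr h)).
  split=> //; have := dM 1 1 h1 h1; have := dM' 1 1 h1 h1; rewrite !mulr1 !mul1r.
  by move=> /esym/eqP; rewrite -subr_eq0 addrK => /eqP -> /esym/eqP;
    rewrite -subr_eq0 addrK => /eqP.
have P0 : P 0.
  have h0 : in_ext3 (0 : ext M) by exact: (in_ext3_gr (0 : gr M 0)).
  split=> //; have := dM 0 0 h0 h0; have := dM' 0 0 h0 h0.
  by rewrite !mulr0 !mul0r addr0 => -> ->.
have PL a y z : P y -> P z -> P (a *: y + z).
  move=> [hy ey] [hz ez]; split; first exact: in_ext3_linear.
  by rewrite dL // dL' // ey ez.
have P3 (y : gr M 3) : P (gr_val y).
  by split; [exact: in_ext3_gr|rewrite db db'].
have PM (n : nat) (y : gr M 3) (z : ext M) : 3 + n \in [:: 0; 3; 6; 9]%N ->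
    z \in homog M n -> P z -> P (gr_val y * z).
  move=> hn hz [iz ez]; have [iy ey] := P3 y; split.
    exact: (in_ext3_gr (Gr (homogM (gr_homog y) hz))).
  by rewrite dM // dM' // ey ez.
have Pg n (y : gr M n) : n \in [:: 0; 3; 6; 9]%N -> P (gr_val y).
  move=> hn; elim/homog_ind: (gr_homog y) => // v.
  have step m (w : 'I_(3 + m) -> M) : 3 + m \in [:: 0; 3; 6; 9]%N ->
      P (\prod_(j < m) ext_gen M (w (rshift 3 j))) ->
      P (\prod_(j < 3 + m) ext_gen M (w j)).
    move=> hm hP; rewrite big_split_ord /=.
    apply: (PM m (Gr (homog_prod (fun j => w (lshift m j))))) hP => //.
    exact: homog_prod.
  move: hn v; rewrite !inE => /or4P[] /eqP -> v; first by rewrite big_ord0.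
  - by apply: (step 0 v isT); rewrite big_ord0.
  - by apply: (step 3 v isT); apply: (step 0 _ isT); rewrite big_ord0.
  - apply: (step 6 v isT); apply: (step 3 _ isT); apply: (step 0 _ isT).
    by rewrite big_ord0.
move=> [x0 [x3 [x6 [x9 ->]]]]; apply: proj2 (_ : P _).
have PD y z : P y -> P z -> P (y + z) by move=> hy hz; rewrite -[y]scale1r; exact: PL.
by apply: (PD _ _ _ (Pg 9 x9 isT)); apply: (PD _ _ _ (Pg 6 x6 isT));
  apply: (PD _ _ (Pg 0 x0 isT) (Pg 3 x3 isT)).
Qed.

Variables (mu : gr (dual M) 9) (u : gr M 9).

(* T(beta) = t, where k is identified with Lambda_0 M. *)
Definition T_eq beta (t : k) : Prop :=
  exists2 d, extends_to_der beta d & lact (gr_val mu) (d (gr_val u)) = ext_cst M t.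

Definition in_sl : {pred hom (gr M 3) (gr M 3)} := fun beta =>
  `[< in_gl beta /\ T_eq beta 0 >].

Fact rho_linear a (alpha alpha' : hom M M) :
  rho (a *: alpha + alpha') = a *: rho alpha + rho alpha'.
Proof.
apply: homP => x; apply/val_inj.
by rewrite -[LHS]/(der (a *: alpha + alpha') (gr_val x)) der_linear_arg.
Qed.

Fact in_sl_linear a beta beta' :
  beta \in in_sl -> beta' \in in_sl -> a *: beta + beta' \in in_sl.
Proof.
move=> /asboolP[[al [c ->]] [d [d1 d2 d3 d4] du]].
move=> /asboolP[[al' [c' ->]] [d' [d1' d2' d3' d4'] du']].
apply: asboolT; split.
  exists (a *: al + al'), (a * c + c').
  by rewrite rho_linear scalerDl scalerDr scalerA addrACA.
exists (fun x => a *: d x + d' x).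
  split=> [x hx|b x y hx hy|x y hx hy|x].
  - by apply: in_ext3_linear; [exact: d1|exact: d1'].
  - rewrite d2 // d2' // !scalerDr !scalerA mulrC.
    by rewrite addrACA.
  - rewrite d3 // d3' // mulrDl mulrDr scalerDr ext_scaleAl ext_scaleAr.
    by rewrite addrACA.
  - by rewrite d4 d4'.
by rewrite (homfP (lact mu)) du du' ext_cstE scale0r scaler0 addr0.
Qed.

Fact in_sl0 : 0 \in in_sl.
Proof.
apply: asboolT; split.
  exists 0, 0; rewrite scale0r addr0.
  by have := rho_linear (-1) 0 0; rewrite scaler0 addr0 scaleN1r addNr => ->.
exists (fun=> 0); last by rewrite (homf0 (lact mu)) ext_cstE scale0r.
split=> //.
- by move=> *; exists 0, 0, 0, 0; rewrite /= !addr0.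
- by move=> *; rewrite scaler0 addr0.
- by move=> *; rewrite mul0r mulr0 addr0.
Qed.

Fact in_sl_closed : GRing.subsemimod_closed in_sl.
Proof.
split; first split.
- exact: in_sl0.
- by move=> b b' hb hb'; rewrite -[b]scale1r; exact: in_sl_linear.
- by move=> a b hb; rewrite -[_ *: _]addr0; apply: in_sl_linear hb in_sl0.
Qed.

Record sl := Sl { sl_val :> hom (gr M 3) (gr M 3); sl_axiom : sl_val \in in_sl }.

HB.instance Definition _ := [isSub for sl_val].
HB.instance Definition _ := [Choice of sl by <:].
HB.instance Definition _ :=
  GRing.SubChoice_isSubLmodule.Build k (hom (gr M 3) (gr M 3)) in_sl sl in_sl_closed.

Definition G : lmodType k := (sl * gr M 3 * gr (dual M) 3)%type.

Definition of_sl (beta : sl) : G := (beta, 0, 0).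
Definition of_gr (x : gr M 3) : G := (0, x, 0).
Definition of_dual (xi : gr (dual M) 3) : G := (0, 0, xi).

End SLTilde.

Definition lie_product (k : comPzRingType) (L : lmodType k) (b : L -> L -> L) : Prop :=
  [/\ forall (a : k) x y z, b (a *: x + y) z = a *: b x z + b y z,
      forall (a : k) x y z, b z (a *: x + y) = a *: b z x + b z y,
      forall x, b x x = 0
    & forall x y z, b x (b y z) + b y (b z x) + b z (b x y) = 0].

(* Main.v *)
Require Import Defs.
From HB Require Import structures.
From mathcomp Require Import all_boot all_algebra.
From mathcomp Require Import boolp classical_sets functions.

(** Write M' for the dual of M. The bracket is graded by Z/3, with sl, Lambda_3(M) and
    Lambda_3(M') in degrees 0, 1 and -1. Elements of odd degree of an exterior algebra
    square to zero, so the bracket is alternating, and by trilinearity the Jacobi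
    identity splits into ten identities between pure elements ([three_part_lie]).

    Two consequences of the hypotheses on M carry the proof: M has a finite dual
    basis, and Lambda_i(M) and Lambda_i(M') vanish for i > 9 ([homog_rank_eq0],
    [homog_dual_rank_eq0]). For the second, outside each prime there is an s
    such that s M lies in the span of nine vectors, so that a power of s kills
    Lambda_i, and an element with such an annihilator at every prime is zero.

    Hence m u = 0 for every vector m, and contracting this product gives
    phi(m) u = m (phi . u). It follows that x (xi . u) = (x . xi) . u for all x and xi
    ([mul_contr_vol]): contraction of u, and likewise of mu, exchanges products and
    contractions, and the two are inverse bijections between Lambda(M') and
    Lambda(M) ([hodgeK]). So Lambda_9(M) = k u, which makes the trace a scalar; the
    pairing of Lambda_i(M') with Lambda_i(M) is nondegenerate ([pairing_nondeg]),
    which makes the dual action of sl on Lambda_3(M') well defined; and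
    tr e(x, xi) = 3 (x . xi) ([der_eop_vol]), which puts delta(x, xi) in sl.

    With beta = rho a + c in sl, that is tr a + 3 c = 0, the identities involving
    beta say that all the operations are invariant. The remaining ones are

    - e(x, (y z) . mu) + cyclic permutations = ((x y z) . mu) 1, and its dual, which
      are m . (xi psi chi) expanded by the antiderivation rule and transported by
      Hodge duality ([eop_cyclic_vol], [eop_cyclic_covol]);
    - xi . (x y) = delta(y, xi) x - delta(x, xi) y, the expansion of three
      antiderivations applied to a product ([contr_mul3]).

    M and M' play symmetric roles throughout. All of this is therefore stated for two
    modules V and W with a pairing, and used for both orders; moreover e(x, xi) and
    e(xi, x) are adjoint ([eop_adjoint]). *)

Set Implicit Arguments.
Unset Strict Implicit.
Unset Printing Implicit Defensive.

Import GRing.Theory.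
Local Open Scope ring_scope.

Local Notation hom := Defs.hom.

(** * Linear maps *)

Lemma eq_of_sub0 (Z : zmodType) (x y : Z) : 0 + (x - y) = 0 -> x = y.
Proof. by rewrite add0r => /subr0_eq. Qed.

(** Equalities between signed sums of pairwise distinct terms: all terms go to the
    left-hand side, where each is brought next to its opposite. *)
Ltac abelian :=
  apply: eq_of_sub0; rewrite ?(opprD, opprK, oppr0, addrA, addr0);
  repeat match goal with
  | |- ?S + - ?t = 0 => rewrite ?(addrAC _ t) ?subrK ?addrK
  | |- ?S + ?t = 0 => rewrite ?(addrAC _ (- t)) ?subrK
  end;
  try by [].

Lemma hom_sum (k : comPzRingType) (U V : lmodType k) (f : hom U V)
    (I : Type) (r : seq I) (F : I -> U) :
  f (\sum_(i <- r) F i) = \sum_(i <- r) f (F i).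
Proof. exact: (linear_sum f). Qed.

Lemma homfB (k : comPzRingType) (U V : lmodType k) (f : hom U V) x y :
  f (x - y) = f x - f y.
Proof. exact: (linearB f). Qed.

Lemma hom_sumE (k : comPzRingType) (U V : lmodType k)
    (I : Type) (r : seq I) (F : I -> hom U V) x :
  (\sum_(i <- r) F i) x = \sum_(i <- r) F i x.
Proof. by elim: r => [|i r IH]; rewrite ?big_nil // !big_cons homDE IH. Qed.

(** * Signs, degrees and derivations in the exterior algebra *)

Section ExteriorAlgebra.
Variables (k : comPzRingType) (M : lmodType k).
Implicit Types (x y z : ext M) (m : M) (phi : dual M).

(** Since left multiplications by vectors generate the exterior algebra, it
    suffices to follow them, which keeps signs one vector at a time. *)
Lemma ext_ind_gen (P : ext M -> Prop) :
    P 1 -> (forall a x y, P x -> P y -> P (a *: x + y)) ->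
    (forall m x, P x -> P (ext_gen M m * x)) ->
  forall x, P x.
Proof.
move=> P1 PL PM.
have P0 : P 0 by have := PL (-1) _ _ P1 P1; rewrite scaleN1r addNr.
suff Q x : forall y, P y -> P (x * y) by move=> x; rewrite -[x]mulr1; exact: Q.
elim/ext_ind: x => [a|m|x x' Px Px'|x x' Px Px'] y Py.
- by rewrite -ext_scaleAl mul1r -[_ *: _]addr0; exact: PL.
- exact: PM.
- by rewrite mulrDl -[x * y]scale1r; apply: PL; [exact: Px|exact: Px'].
- by rewrite -mulrA; apply: Px; apply: Px'.
Qed.

Lemma ext_signK x : ext_sign M (ext_sign M x) = x.
Proof.
elim/ext_ind_gen: x => [|a x y ex ey|m x ex]; first by rewrite !ext_sign1.
  by rewrite !(homfP (ext_sign M)) ex ey.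
by rewrite !ext_signM ex ext_sign_gen (homfN (ext_sign M)) ext_sign_gen opprK.
Qed.

Lemma ext_gen_comm m x : ext_gen M m * x = ext_sign M x * ext_gen M m.
Proof.
elim/ext_ind_gen: x => [|a x y ex ey|n x ex].
- by rewrite ext_sign1 mulr1 mul1r.
- by rewrite (homfP (ext_sign M)) mulrDr mulrDl -ext_scaleAr -ext_scaleAl ex ey.
rewrite ext_signM ext_sign_gen -[RHS]mulrA -ex !mulrA mulNr mulNr.
by apply/eqP; rewrite -subr_eq0 opprK -mulrDl ext_gen_anti mul0r.
Qed.

Lemma deg0_sign x : deg0 M (ext_sign M x) = deg0 M x.
Proof.
elim/ext_ind_gen: x => [|a x y ex ey|m x _]; first by rewrite ext_sign1.
  by rewrite (homfP (ext_sign M)) !(homfP (deg0 M)) ex ey.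
by rewrite ext_signM ext_sign_gen mulNr (homfN (deg0 M)) !deg0M deg0_gen !mul0r oppr0.
Qed.

Lemma deg1_1 : deg1 M 1 = 0.
Proof.
have := deg1M (1 : ext M) 1; rewrite mulr1 deg0_1 scale1r.
by move=> /(congr1 (+%R (- deg1 M 1))); rewrite addrA addNr add0r.
Qed.

(** The components of degree 0 and 1 turn contraction by phi into evaluation, in
    whatever degrees x lives; this avoids degree hypotheses further on. *)
Lemma deg0_antider phi x : deg0 M (antider phi x) = (phi : hom M k^o) (deg1 M x).
Proof.
elim/ext_ind_gen: x => [|a x y ex ey|m x _].
- by rewrite antider1 deg1_1 (homf0 (deg0 M)) (homf0 (phi : hom M k^o)).
- by rewrite (homfP (antider phi)) (homfP (deg0 M)) (homfP (deg1 M))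
    (homfP (phi : hom M k^o)) ex ey.
rewrite antiderM (homfD (deg0 M)) !deg0M antider_gen_eq deg0_cst deg1M deg1_gen.
rewrite deg0_sign deg0_gen scale0r add0r mul0r addr0.
by rewrite (homfZ (phi : hom M k^o)) mulrC.
Qed.

Lemma deg0_der (a : hom M M) x : deg0 M (der a x) = 0.
Proof.
elim/ext_ind_gen: x => [|b x y ex ey|m x ex].
- by rewrite der1 (homf0 (deg0 M)).
- by rewrite (homfP (der a)) (homfP (deg0 M)) ex ey scaler0 addr0.
rewrite derM (homfD (deg0 M)) !deg0M ex der_gen_eq.
by rewrite !deg0_gen mul0r mulr0 addr0.
Qed.

Lemma deg1_der (a : hom M M) x : deg1 M (der a x) = a (deg1 M x).
Proof.
elim/ext_ind_gen: x => [|b x y ex ey|m x ex].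
- by rewrite der1 deg1_1 (homf0 (deg1 M)) (homf0 a).
- by rewrite (homfP (der a)) !(homfP (deg1 M)) (homfP a) ex ey.
rewrite derM (homfD (deg1 M)) !deg1M ex der_gen_eq !deg0_gen !deg1_gen deg0_der.
by rewrite !scale0r add0r !addr0 add0r (homfZ a).
Qed.

Lemma homog_cst (a : k) : ext_cst M a \in homog M 0.
Proof.
have := homog_prod (fun _ : 'I_0 => 0 : M); rewrite big_ord0 => /(homogZ a).
by rewrite -ext_cstE.
Qed.

Lemma homog0_cst x : x \in homog M 0 -> x = ext_cst M (deg0 M x).
Proof.
elim/homog_ind => [|a y z ey ez|v].
- by rewrite (homf0 (deg0 M)) ext_cstE scale0r.
- rewrite (homfP (deg0 M)) [X in X = _](congr2 (fun p q => a *: p + q) ey ez).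
  by rewrite !ext_cstE scalerDl scalerA.
by rewrite big_ord0 deg0_1.
Qed.

Lemma homog1_gen x : x \in homog M 1 -> x = ext_gen M (deg1 M x).
Proof.
elim/homog_ind => [|a y z ey ez|v].
- by rewrite (homf0 (deg1 M)) (homf0 (ext_gen M)).
- by rewrite (homfP (deg1 M)) (homfP (ext_gen M)) -ey -ez.
by rewrite big_ord1 deg1_gen.
Qed.

Lemma ext_sign_odd i x : odd i -> x \in homog M i -> ext_sign M x = - x.
Proof. by move=> oi hx; rewrite (ext_sign_homog hx) -signr_odd oi mulN1r. Qed.

Lemma ext_sign_even i x : ~~ odd i -> x \in homog M i -> ext_sign M x = x.
Proof.
by move=> oi hx; rewrite (ext_sign_homog hx) -signr_odd (negbTE oi) mul1r.
Qed.

Lemma homog_even_comm i x y : ~~ odd i -> x \in homog M i -> x * y = y * x.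
Proof.
move=> oi hx; elim/ext_ind_gen: y => [|a y z ey ez|m y ey].
- by rewrite mulr1 mul1r.
- by rewrite mulrDr mulrDl -ext_scaleAr -ext_scaleAl ey ez.
by rewrite -mulrA -ey !mulrA ext_gen_comm (ext_sign_even oi hx).
Qed.

Lemma homog_odd_comm i x y : odd i -> x \in homog M i -> x * y = ext_sign M y * x.
Proof.
move=> oi hx; elim/ext_ind_gen: y => [|a y z ey ez|m y ey].
- by rewrite ext_sign1 mulr1 mul1r.
- by rewrite (homfP (ext_sign M)) mulrDr mulrDl -ext_scaleAr -ext_scaleAl ey ez.
rewrite ext_signM ext_sign_gen -mulrA -ey !mulrA; congr (_ * y).
by rewrite mulNr ext_gen_comm (ext_sign_odd oi hx) mulNr opprK.
Qed.

Lemma homog_odd_anti i j x y :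
  odd i -> odd j -> x \in homog M i -> y \in homog M j -> y * x = - (x * y).
Proof.
by move=> oi oj hx hy; rewrite (homog_odd_comm x oj hy) (ext_sign_odd oi hx) mulNr.
Qed.

Lemma prod_gen_sqr i (v : 'I_i.+1 -> M) :
  (\prod_(j < i.+1) ext_gen M (v j)) * (\prod_(j < i.+1) ext_gen M (v j)) = 0.
Proof.
rewrite big_ord_recl mulrA -[_ * _ * ext_gen _ _]mulrA.
have -> (m : M) y : y * ext_gen M m = ext_gen M m * ext_sign M y.
  by rewrite ext_gen_comm ext_signK.
by rewrite !mulrA ext_gen_sqr !mul0r.
Qed.

(** Odd elements anticommute, so a square only has diagonal terms; each is the
    square of a product of vectors. This holds even when 2 is a zero divisor. *)
Lemma homog_odd_sqr i x : odd i -> x \in homog M i -> x * x = 0.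
Proof.
case: i => // i oi /asboolP[s ->].
have hs (s' : seq (k * ('I_i.+1 -> M))) :
    \sum_(p <- s') p.1 *: \prod_(j < i.+1) ext_gen M (p.2 j) \in homog M i.+1.
  by apply: asboolT; exists s'.
elim: s => [|p s IH]; first by rewrite big_nil mul0r.
rewrite big_cons; set a := _ *: _; set b := \sum_(j <- s) _ in IH *.
have ha : a \in homog M i.+1 by apply: homogZ; exact: homog_prod.
rewrite mulrDl !mulrDr IH addr0 (homog_odd_anti oi oi ha (hs s)) addrK.
by rewrite /a -ext_scaleAl -ext_scaleAr prod_gen_sqr !scaler0.
Qed.

Lemma antider_homog phi i x : x \in homog M i.+1 -> antider phi x \in homog M i.
Proof.
elim/homog_ind => [|a y z hy hz|v]; first by rewrite (homf0 (antider phi)) homog0.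
  by rewrite (homfP (antider phi)); apply: homogD hz; exact: homogZ.
elim: i v => [|i IH] v.
  by rewrite big_ord1 antider_gen_eq; exact: homog_cst.
rewrite big_ord_recl antiderM antider_gen_eq ext_sign_gen; apply: homogD.
  by apply: (@homogM _ _ 0); [exact: homog_cst|exact: homog_prod].
rewrite mulNr -scaleN1r; apply: homogZ.
by apply: (@homogM _ _ 1); [exact: homog_gen|exact: IH].
Qed.

Lemma antider_homog0 phi x : x \in homog M 0 -> antider phi x = 0.
Proof. by move=> /homog0_cst ->; exact: antider_cst. Qed.

Lemma ext_sign_in_homog i x : x \in homog M i -> ext_sign M x \in homog M i.
Proof.
move=> hx; rewrite (ext_sign_homog hx) -signr_odd.
by case: (odd i); rewrite ?mulN1r ?mul1r // -scaleN1r homogZ.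
Qed.

Lemma der_one_homog i x : x \in homog M i -> der 1 x = x *+ i.
Proof.
elim/homog_ind => [|a y z ey ez|v]; first by rewrite (homf0 (der 1)) mul0rn.
  by rewrite (homfP (der 1)) ey ez mulrnDl scalerMnr.
elim: i v => [|i IH] v; first by rewrite big_ord0 der1.
by rewrite big_ord_recl derM IH der_gen_eq mulrS mulrnAr.
Qed.

(** Multiplication by m after contraction by phi is a derivation, because both
    anticommute with vectors up to a scalar. *)
Lemma der_rank1 (a : hom M M) m phi x :
    (forall n, a n = ((phi : hom M k^o) n : k) *: m) ->
  der a x = ext_gen M m * antider phi x.
Proof.
move=> ha; elim/ext_ind_gen: x => [|b x y ex ey|n x ex].
- by rewrite der1 antider1 mulr0.
- by rewrite (homfP (der a)) (homfP (antider phi)) mulrDr ex ey ext_scaleAr.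
rewrite derM der_gen_eq ex ha antiderM antider_gen_eq ext_sign_gen mulrDr.
rewrite mulNr mulrN !mulrA.
congr (_ + _).
  rewrite (homfZ (ext_gen M)) ext_cstE -ext_scaleAl -ext_scaleAr mulr1.
  by rewrite -ext_scaleAl.
by apply/eqP; rewrite -subr_eq0 opprK -mulrDl ext_gen_anti mul0r.
Qed.

Lemma derD (a b : hom M M) x : der (a + b) x = der a x + der b x.
Proof. by have := der_linear_arg 1 a b; rewrite !scale1r => ->. Qed.

Lemma der_zero x : der (0 : hom M M) x = 0.
Proof. by apply: (addrI (der 0 x)); rewrite -derD !addr0. Qed.

Lemma derZ (c : k) (a : hom M M) x : der (c *: a) x = c *: der a x.
Proof. by have := der_linear_arg c a 0; rewrite addr0 => ->; rewrite homDE der_zero addr0. Qed.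

Lemma der_sum (I : Type) (r : seq I) (F : I -> hom M M) x :
  der (\sum_(i <- r) F i) x = \sum_(i <- r) der (F i) x.
Proof.
by elim: r => [|i r IH]; rewrite ?big_nil ?der_zero // !big_cons derD IH.
Qed.

End ExteriorAlgebra.

(** * Elements that vanish locally *)

Section LocalGlobal.
Variable k : comPzRingType.
Local Open Scope classical_set_scope.

(** An ideal that is maximal among the proper ideals containing I is prime. *)
Lemma prime_above (I : set k) :
    I 0 -> (forall a x y, I x -> I y -> I (a * x + y)) -> ~ I 1 ->
  exists p : prime_ideal k, forall x, I x -> prime_set p x.
Proof.
move=> I0 IL I1.
pose ideal (A : set k) :=
  [/\ I `<=` A, forall a x y, A x -> A y -> A (a * x + y) & ~ A 1].
(* The ideals are written A `|` I so that the union of an empty chain is one. *)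
have [F FP Ftot|A [[_ AL A1] Amax]] := @Zorn_bigcup k (fun A => ideal (A `|` I)).
  split=> [x Ix|a x y|]; first by right.
  - case=> [[X FX Xx]|Ix] [[Y FY Yy]|Iy].
    + have [XY|YX] := Ftot _ _ FX FY.
        have [_ /(_ a x y) L _] := FP _ FY.
        by case: L => [||h|h]; [left; exact: XY|left|left; exists Y|right].
      have [_ /(_ a x y) L _] := FP _ FX.
      by case: L => [||h|h]; [left|left; exact: YX|left; exists X|right].
    + have [_ /(_ a x y) L _] := FP _ FX.
      by case: L => [||h|h]; [left|right|left; exists X|right].
    + have [_ /(_ a x y) L _] := FP _ FY.
      by case: L => [||h|h]; [right|left|left; exists Y|right].
    + by right; exact: IL.
  - by case=> [[X FX X1]|//]; have [_ _] := FP _ FX; apply; left.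
pose m := A `|` I.
have m0 : m 0 by right.
have mM a x : m x -> m (a * x) by move=> mx; rewrite -[a * x]addr0; exact: AL.
have prime x y : m (x * y) -> m x \/ m y.
  move=> mxy; have [mx|nmx] := pselect (m x); [by left|right].
  pose B : set k := fun z => exists c a, m c /\ z = c + a * x.
  have mB z : m z -> B z by exists z, 0; rewrite mul0r addr0.
  have [c [a [mc e]]] : B 1.
    apply: contrapT => nB1; apply: (Amax B).
      split=> [z Az|BA]; first by apply: mB; left.
      by apply: nmx; left; apply: BA; exists 0, 1; rewrite mul1r add0r.
    split; first by right.
      have BL b z t : B z -> B t -> B (b * z + t).
        move=> [c [a [mc ->]]] [d [a' [md ->]]].
        exists (b * c + d), (b * a + a'); split; first exact: AL.
        by rewrite mulrDr mulrDl mulrA addrACA.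
      have IB z : (B `|` I) z -> B z by case=> [//|Iz]; apply: mB; right.
      by move=> b z t /IB Bz /IB Bt; left; exact: BL.
    by case.
  by rewrite -[y]mul1r e mulrDl mulrC -mulrA; apply: AL _ (mM a _ mxy);
    rewrite // mulrC.
exists (PrimeIdeal m0 A1 AL prime) => x Ix; right; exact: Ix.
Qed.

(** The annihilator of z lies in no prime ideal, so it contains 1. *)
Lemma local_eq0 (N : lmodType k) (z : N) :
    (forall p : prime_ideal k, exists2 s, ~ prime_set p s & s *: z = 0) ->
  z = 0.
Proof.
move=> hz; apply: contrapT => nz.
have [| | |p hp] := @prime_above (fun s => s *: z = 0).
- by rewrite scale0r.
- by move=> a x y hx hy; rewrite scalerDl -scalerA hx hy scaler0 addr0.
- by rewrite scale1r.
by have [s ps /hp] := hz p.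
Qed.

Lemma prime_exp (p : prime_ideal k) s n : ~ prime_set p s -> ~ prime_set p (s ^+ n).
Proof.
move=> ps; elim: n => [|n IH]; first by rewrite expr0; exact: primeN1.
by rewrite exprS => /Defs.primeP [].
Qed.

End LocalGlobal.

(** * Vanishing of the exterior powers above the rank *)

Section Vanishing.
Variables (k : comPzRingType) (M : lmodType k).

(** Linear combinations of the products of m entries of l taken in increasing
    position; products of m vectors of the span of l are of this form. Only zero is
    when m exceeds the length of l: a determinant-free pigeonhole. *)
Fixpoint spanned_by_words (l : seq M) (m : nat) (x : ext M) : Prop :=
  match l with
  | [::] => m = 0%N \/ x = 0
  | b :: l' => exists y z, [/\ x = ext_gen M b * y + z, spanned_by_words l' m z
      & if m is m'.+1 then spanned_by_words l' m' y else y = 0]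
  end.

Lemma spanned0 l m : spanned_by_words l m 0.
Proof.
elim: l m => [|b l IH] m /=; first by right.
by exists 0, 0; split=> //; [rewrite mulr0 addr0|case: m].
Qed.

Lemma spanned_linear l m a x y :
  spanned_by_words l m x -> spanned_by_words l m y ->
  spanned_by_words l m (a *: x + y).
Proof.
elim: l m x y => [|b l IH] m x y /=.
  by move=> [->|->]; [left|move=> [->|->]; [left|right; rewrite scaler0 addr0]].
move=> [x1 [x2 [-> hx2 hx1]]] [y1 [y2 [-> hy2 hy1]]].
exists (a *: x1 + y1), (a *: x2 + y2); split; last 1 first.
- by case: m hx1 hy1 {hx2 hy2} => [->->|m hx hy]; [rewrite scaler0 addr0|exact: IH].
- by rewrite scalerDr mulrDr ext_scaleAr addrACA.
exact: IH.
Qed.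

Lemma spanned_gen l m (c : M) x :
  List.In c l -> spanned_by_words l m x ->
  spanned_by_words l m.+1 (ext_gen M c * x).
Proof.
elim: l m x => [//|b l IH] m x /= hc [y [z [-> hz hy]]].
case: hc => [<-|hc].
  exists z, 0; split=> //; last exact: spanned0.
  by rewrite mulrDr mulrA ext_gen_sqr mul0r add0r addr0.
exists (- (ext_gen M c * y)), (ext_gen M c * z); split.
- rewrite mulrDr mulrN !mulrA; congr (_ + _).
  by apply/eqP; rewrite -subr_eq0 opprK -mulrDl ext_gen_anti mul0r.
- exact: IH.
case: m hy {hz} => [->|m hy]; first by rewrite mulr0 oppr0; exact: spanned0.
rewrite -scaleN1r -[_ *: _]addr0; apply: spanned_linear (spanned0 _ _).
exact: IH.
Qed.

Lemma spanned_eq0 l m x : (size l < m)%N -> spanned_by_words l m x -> x = 0.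
Proof.
elim: l m x => [|b l IH] [//|m] x /= hm; first by case.
move=> [y [z [-> hz hy]]].
by rewrite (IH m y) // (IH m.+1 z) ?mulr0 ?addr0 // ltnW.
Qed.

Lemma spanned_prod l m (v : 'I_m -> M) :
    (forall j, exists n (c : 'I_n -> k) (b : 'I_n -> M),
       v j = \sum_i c i *: b i /\ forall i, List.In (b i) l) ->
  spanned_by_words l m (\prod_(j < m) ext_gen M (v j)).
Proof.
elim: m v => [|m IH] v hv.
  rewrite big_ord0; elim: l {hv} => [|b l IHl] /=; first by left.
  by exists 0, 1; split=> //; rewrite mulr0 add0r.
rewrite big_ord_recl; have [n [c [b [-> hb]]]] := hv ord0.
have {}IH := IH _ (fun j => hv (lift ord0 j)).
rewrite (hom_sum (ext_gen M)) mulr_suml.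
elim/big_ind: _ => [|x y hx hy|i _]; first exact: spanned0.
  by rewrite -[x]scale1r; exact: spanned_linear.
rewrite (homfZ (ext_gen M)) -ext_scaleAl -[_ *: _]addr0.
by apply: spanned_linear (spanned0 _ _); exact: spanned_gen.
Qed.

(** s^m times a product of m vectors is the product of m elements of s M, hence of m
    combinations of the n vectors b_i. *)
Lemma homog_torsion (s : k) n (b : 'I_n -> M) m (x : ext M) :
    (forall v, exists c : 'I_n -> k, s *: v = \sum_i c i *: b i) ->
    (n < m)%N -> x \in homog M m ->
  s ^+ m *: x = 0.
Proof.
move=> hs nm; elim/homog_ind => [|a y z hy hz|v]; first by rewrite scaler0.
  by rewrite scalerDr scalerA mulrC -scalerA hy hz scaler0 addr0.
have -> : s ^+ m *: \prod_(j < m) ext_gen M (v j) =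
          \prod_(j < m) ext_gen M (s *: v j).
  elim: m v {nm} => [|m IH] v; first by rewrite !big_ord0 expr0 scale1r.
  rewrite !big_ord_recl -IH (homfZ (ext_gen M)) -ext_scaleAl -ext_scaleAr.
  by rewrite scalerA exprS.
apply: (@spanned_eq0 (codom b) m); first by rewrite size_codom card_ord.
apply: (spanned_prod (v := fun j => s *: v j)) => j; have [c ->] := hs (v j).
exists n, c, b; split=> // i; rewrite /codom /image_mem.
by apply: List.in_map; elim: (enum 'I_n) (mem_enum 'I_n i) => //= i' r IHr;
  rewrite inE => /orP[/eqP ->|/IHr]; [left|right].
Qed.

End Vanishing.

Section Rank.
Variables (k : comPzRingType) (M : lmodType k).

(** The coordinates of a splitting of k^n -> M. *)
Lemma dual_basis :
  finitely_generated M -> projective M ->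
  exists n (g : 'I_n -> M) (w : 'I_n -> dual M),
    forall m, m = \sum_i ((w i : hom M k^o) m : k) *: g i.
Proof.
move=> [n [g hg]] proj.
have q_lin : linear (fun c : 'I_n -> k^o => \sum_i (c i : k) *: g i).
  move=> a c d; rewrite scaler_sumr -big_split; apply: eq_bigr => i _ /=.
  by rewrite scalerA -scalerDl.
have [m|h hE] := proj _ _ (mkhom q_lin) idfun.
  by have [c ->] := hg m; exists c.
have w_lin i : linear (fun m => h m i) by move=> a m m'; rewrite linearP.
by exists n, g, (fun i => mkhom (w_lin i)) => m; rewrite -[LHS]hE.
Qed.

(** Clear the denominators in a basis of M_p, then in the expressions of finitely
    many generators of M. *)
Lemma rank_span n (p : prime_ideal k) :
  finitely_generated M -> has_rank M n ->
  exists (s : k) (b : 'I_n -> M), ~ prime_set p s /\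
    forall v, exists c : 'I_n -> k, s *: v = \sum_i c i *: b i.
Proof.
move=> [r [g hg]] rk; have [B hB] := rk p.
pose b i := (repr (B i)).1; pose t i := (repr (B i)).2.
have BE i : B i = mkloc (b i) (t i) by rewrite /mkloc -surjective_pairing reprK.
have frac (x : loc p M) : exists (c : 'I_n -> k) s, x = mkloc (\sum_i c i *: b i) s.
  have [a [-> _]] := hB x; elim/big_ind: _ => [|y z [c [s ->]] [d [s' ->]]|i _].
  - exists (fun=> 0), (den1 p); rewrite big1 // => i _; exact: scale0r.
  - exists (fun i => den s' * c i + den s * d i), (denM s s').
    rewrite mklocD !scaler_sumr -big_split; congr (mkloc _ _).
    by apply: eq_bigr => i _; rewrite /= !scalerA -scalerDl.
  have [a' [s ->]] := locP (a i); rewrite BE.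
  exists (fun j => if j == i then a' : k else 0), (denM s (t i)).
  rewrite [LHS]loc_scaleE (bigD1 i) //= eqxx big1 ?addr0 // => j /negbTE ->.
  exact: scale0r.
pose spanned s v := exists c : 'I_n -> k, s *: v = \sum_i c i *: b i.
have spannedZ s a v : spanned s v -> spanned (a * s) v.
  move=> [c e]; exists (fun i => a * c i); rewrite -scalerA e scaler_sumr.
  by apply: eq_bigr => i _; rewrite scalerA.
have /choice[s hs] j : exists s, ~ prime_set p s /\ spanned s (g j).
  have [c [s /mkloc_eq[q e]]] := frac (mkloc (g j) (den1 p)).
  exists (den q * den s); split; first by have /asboolP := denP (denM q s).
  exists (fun i => den q * c i); rewrite e mulr1 scaler_sumr.
  by apply: eq_bigr => i _; rewrite scalerA.
exists (\prod_j s j), b; split.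
  elim/big_ind: _ => [|x y px py /Defs.primeP[]//|j _]; first exact: primeN1.
  by have [] := hs j.
move=> v; have [c ->] := hg v; rewrite scaler_sumr.
elim/big_ind: (\sum_i _) => [|x y [d ->] [d' ->]|j _].
- by exists (fun=> 0); rewrite big1 // => i _; exact: scale0r.
- exists (fun i => d i + d' i); rewrite -big_split.
  by apply: eq_bigr => i _; rewrite /= -scalerDl.
have [_ hj] := hs j.
have -> : (\prod_j s j) *: (c j *: g j) = ((c j * \prod_(i | i != j) s i) * s j) *: g j.
  by rewrite (bigD1 j) //= scalerA mulrC [s j * _]mulrC mulrA.
exact: spannedZ hj.
Qed.

Hypotheses (M_fg : finitely_generated M) (M_proj : projective M).
Variable n : nat.
Hypothesis M_rank : has_rank M n.

Lemma homog_rank_eq0 m (x : ext M) : (n < m)%N -> x \in homog M m -> x = 0.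
Proof.
move=> nm hx; apply: local_eq0 => p; have [s [b [ps hs]]] := rank_span p M_fg M_rank.
by exists (s ^+ m); [exact: prime_exp|exact: homog_torsion hs nm hx].
Qed.

(** If s M lies in the span of b_1, ..., b_n, then writing s g_j on the b_i for a dual
    basis (g_j, w_j) gives n forms whose span contains s times the dual of M. *)
Lemma homog_dual_rank_eq0 m (xi : ext (dual M)) :
  (n < m)%N -> xi \in homog (dual M) m -> xi = 0.
Proof.
move=> nm hx; apply: local_eq0 => p; have [s [b [ps hs]]] := rank_span p M_fg M_rank.
exists (s ^+ m); first exact: prime_exp.
have [r [g [w gw]]] := dual_basis M_fg M_proj.
have /choice[c hc] j := hs (g j).
apply: (@homog_torsion _ _ s n (fun i => \sum_j c j i *: w j) m) => // phi.
exists (fun i => (phi : hom M k^o) (b i)); apply: homP => v.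
have -> : (s *: phi : dual M) v = (phi : hom M k^o) (s *: v).
  by rewrite (homfZ (phi : hom M k^o)).
rewrite {1}(gw v) scaler_sumr !hom_sum hom_sumE.
under [RHS]eq_bigr do rewrite homZE hom_sumE scaler_sumr.
rewrite exchange_big; apply: eq_bigr => j _ /=.
rewrite scalerA mulrC -scalerA hc (homfZ (phi : hom M k^o)) hom_sum scaler_sumr.
apply: eq_bigr => i _; rewrite (homfZ (phi : hom M k^o)) homZE.
rewrite /GRing.scale /=.
by rewrite mulrC mulrAC mulrC mulrA.
Qed.

End Rank.

(** * Contractions along a pairing *)

Section Contraction.
Variables (k : comPzRingType) (V W : lmodType k) (j : hom W (dual V)).
Implicit Types (v x y : ext V) (w : ext W) (psi : W).

(** The action of Lambda(W) on Lambda(V) when W acts on V by forms. With M' the dual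
    of M, the action of Lambda(M') on Lambda(M) and that of Lambda(M) on Lambda(M')
    are two instances, so that each fact below is proved once for both. *)
Definition contr w : hom (ext V) (ext V) := lact (ext_map j w).

Lemma contr1 v : contr 1 v = v.
Proof. by rewrite /contr ext_map1 lact1. Qed.

Lemma contrM w w' v : contr (w * w') v = contr w (contr w' v).
Proof. by rewrite /contr ext_mapM lactM. Qed.

Lemma contr_gen psi : contr (ext_gen W psi) = antider (j psi).
Proof. by rewrite /contr ext_map_gen lact_gen. Qed.

Lemma contr_linear a w w' v :
  contr (a *: w + w') v = a *: contr w v + contr w' v.
Proof. by rewrite /contr (homfP (ext_map j)) lactD lactZ. Qed.

Lemma contrD w w' v : contr (w + w') v = contr w v + contr w' v.
Proof. by have := contr_linear 1 w w' v; rewrite !scale1r. Qed.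

Lemma contr0 v : contr 0 v = 0.
Proof. by have := contr_linear (-1) 0 0 v; rewrite scaler0 addr0 scaleN1r addNr. Qed.

Lemma contrZ a w v : contr (a *: w) v = a *: contr w v.
Proof. by have := contr_linear a w 0 v; rewrite contr0 !addr0. Qed.

Lemma contrN w v : contr (- w) v = - contr w v.
Proof. by rewrite -!scaleN1r contrZ. Qed.

Lemma contr_sum (I : Type) (r : seq I) (F : I -> ext W) v :
  contr (\sum_(i <- r) F i) v = \sum_(i <- r) contr (F i) v.
Proof. by elim: r => [|i r IH]; rewrite ?big_nil ?contr0 // !big_cons contrD IH. Qed.

Lemma contr_cst a v : contr (ext_cst W a) v = a *: v.
Proof. by rewrite ext_cstE contrZ contr1. Qed.

Lemma contr_homog i n w v :
  w \in homog W i -> v \in homog V (i + n) -> contr w v \in homog V n.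
Proof.
move=> hw hv; elim/homog_ind: hw => [|a x y hx hy|f].
- by rewrite contr0 homog0.
- by rewrite contr_linear; apply: homogD hy; exact: homogZ.
elim: i f n v hv => [|i IH] f n v hv; first by rewrite big_ord0 contr1.
rewrite big_ord_recl contrM contr_gen; apply: antider_homog; apply: IH.
by rewrite addnS -addSn.
Qed.

Lemma contr_small i n w v :
  (n < i)%N -> w \in homog W i -> v \in homog V n -> contr w v = 0.
Proof.
move=> ni hw hv; elim/homog_ind: hw => [|a x y hx hy|f].
- exact: contr0.
- by rewrite contr_linear hx hy scaler0 addr0.
elim: i f ni => [//|i IH] f; rewrite ltnS leq_eqVlt big_ord_recl contrM contr_gen.
case/predU1P=> [ni|/IH ->]; last by rewrite (homf0 (antider _)).
apply: antider_homog0; apply: contr_homog (homog_prod _) _.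
by rewrite addn0 -ni.
Qed.

Lemma contr_sign w v :
  ext_sign V (contr w v) = contr (ext_sign W w) (ext_sign V v).
Proof.
elim/ext_ind_gen: w v => [|a w w' hw hw'|psi w hw] v.
- by rewrite ext_sign1 !contr1.
- by rewrite (homfP (ext_sign W)) !contr_linear (homfP (ext_sign V)) hw hw'.
rewrite ext_signM ext_sign_gen mulNr contrN !contrM !contr_gen -hw.
by rewrite antider_sign opprK.
Qed.

(** D_a acts by derivations on contractions when Lambda(W) carries the dual
    action, which is - D_a' for the adjoint a' of a. *)
Lemma contr_der (a : hom V V) (a' : hom W W) w v :
    (forall p q, (j (a' p) : hom V k^o) q = (j p : hom V k^o) (a q)) ->
  der a (contr w v) = contr w (der a v) - contr (der a' w) v.
Proof.
move=> adj.
have comm psi x : der a (antider (j psi) x) =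
    antider (j psi) (der a x) - antider (j (a' psi)) x.
  elim/ext_ind_gen: x => [|b x y hx hy|m x hx].
  - by rewrite der1 !antider1 !(homf0 (der a)) (homf0 (antider _)) subr0.
  - by rewrite !(homfP (antider _)) !(homfP (der a)) (homfP (antider _)) hx hy
      scalerBr opprD addrACA.
  rewrite derM der_gen_eq (homfD (antider _)) !antiderM !antider_gen_eq.
  rewrite !ext_sign_gen !mulNr (homfD (der a)) (homfN (der a)) !derM hx der_gen_eq.
  rewrite adj ext_cstE (homfZ (der a)) der1 scaler0 mul0r add0r mulrBr.
  abelian.
elim/ext_ind_gen: w v => [|b w w' hw hw'|psi w hw] v.
- by rewrite der1 contr0 !contr1 subr0.
- by rewrite (homfP (der a')) !contr_linear (homfP (der a)) hw hw' scalerBr opprD addrACA.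
rewrite derM der_gen_eq contrD !contrM !contr_gen comm hw.
by rewrite (homfB (antider _)); abelian.
Qed.

End Contraction.

Section Pairing.
Variables (k : comPzRingType) (V W : lmodType k).
Variables (j : hom W (dual V)) (j' : hom V (dual W)).
Hypothesis jj' : forall p q, (j p : hom V k^o) q = (j' q : hom W k^o) p.
Implicit Types (v x y : ext V) (w : ext W) (psi : W).

(** Contraction by a vector anticommutes with multiplication by psi up to their
    pairing; moving all the factors of v past psi contracts v itself by psi. *)
Lemma contr_mul_gen v psi w :
  contr j' v (ext_gen W psi * w) =
    contr j' (ext_sign V (antider (j psi) v)) w
    + ext_gen W psi * contr j' (ext_sign V v) w.
Proof.
elim/ext_ind_gen: v => [|a v v' hv hv'|m v hv].
- by rewrite antider1 ext_sign1 (homf0 (ext_sign V)) contr0 !contr1 add0r.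
- rewrite (homfP (antider _)) !(homfP (ext_sign V)) !contr_linear hv hv' mulrDr.
  by rewrite -ext_scaleAr scalerDr addrACA.
rewrite contrM contr_gen hv (homfD (antider _)) antiderM antider_gen_eq -jj'.
rewrite (antiderM (j psi)) antider_gen_eq !ext_sign_gen !mulNr.
rewrite (homfB (ext_sign V)) !ext_signM ext_sign_cst ext_sign_gen !mulNr opprK.
rewrite contrD contrN !contrM contr_cst contr_gen mulrN.
by rewrite -[ext_cst W _ * _]/(_ *: _) [in RHS]addrAC addrCA addrA [RHS]addrAC.
Qed.

(** By induction on w: [contr_mul_gen] peels a vector off w on the right-hand side,
    and moving it across w on the left-hand side produces the same sign. *)
Lemma deg0_contrC w v : deg0 V (contr j w v) = deg0 W (contr j' v w).
Proof.
elim/ext_ind_gen: w v => [|a w w' hw hw'|psi w hw] v.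
- rewrite contr1; elim/ext_ind_gen: v => [|a v v' hv hv'|m v hv].
  + by rewrite contr1 !deg0_1.
  + by rewrite contr_linear (homfP (deg0 V)) (homfP (deg0 W)) hv hv'.
  rewrite deg0M deg0_gen mul0r contrM contr_gen.
  have -> : contr j' v 1 = ext_cst W (deg0 V v).
    elim/ext_ind_gen: v {hv} => [|a v v' hv hv'|n v hv].
    - by rewrite contr1 deg0_1.
    - by rewrite contr_linear (homfP (deg0 V)) hv hv' !ext_cstE scalerDl scalerA.
    rewrite contrM contr_gen hv antider_cst deg0M deg0_gen mul0r.
    by rewrite ext_cstE scale0r.
  by rewrite antider_cst (homf0 (deg0 W)).
- by rewrite contr_linear (homfP (contr j' v)) (homfP (deg0 V)) (homfP (deg0 W)) hw hw'.
rewrite contr_mul_gen (homfD (deg0 W)) deg0M deg0_gen mul0r addr0 -hw.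
by rewrite -[RHS]deg0_sign contr_sign ext_signK -contr_gen -contrM -ext_gen_comm.
Qed.

(** Induction on the degree m: by [contr_mul_gen], contracting psi w involves the
    contraction of w by v, and that of w by the contraction of v by psi, which
    has one degree less and still kills the forms of its own degree. *)
Lemma contr_kill n m v :
    (n <= m)%N -> v \in homog V n ->
    (forall w, w \in homog W n -> contr j' v w = 0) ->
  forall w, w \in homog W m -> contr j' v w = 0.
Proof.
elim: m n v => [|m IH] n v; first by rewrite leqn0 => /eqP ->.
rewrite leq_eqVlt => /predU1P[-> //|nm] hv kv w.
elim/homog_ind => [|a x y hx hy|f].
- exact: homf0.
- by rewrite (homfP (contr j' v)) hx hy scaler0 addr0.
rewrite big_ord_recl contr_mul_gen.
set psi := f ord0; set w' := \prod_(_ < m) _; have hw' : w' \in homog W m by exact: homog_prod.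
have -> : contr j' (ext_sign V v) w' = 0.
  rewrite (ext_sign_homog hv) -signr_odd.
  by case: (odd n); rewrite ?mulN1r ?mul1r ?contrN (IH n v) ?oppr0.
rewrite mulr0 addr0; case: n nm hv kv => [|n] nm hv kv.
  by rewrite (antider_homog0 _ hv) (homf0 (ext_sign V)) contr0.
have hv' := antider_homog (j psi) hv.
apply: (IH n) hw'; [exact: ltnW|exact: ext_sign_in_homog|move=> w1 hw1].
have := contr_mul_gen v psi w1; rewrite kv; last by apply: (@homogM _ _ 1); first exact: homog_gen.
by rewrite (contr_small j' (ltnSn n) (ext_sign_in_homog hv) hw1) mulr0 addr0.
Qed.

End Pairing.

(** * The endomorphisms e(x, w) *)

Section EMap.
Variables (k : comPzRingType) (V W : lmodType k).
Variables (j : hom W (dual V)) (j' : hom V (dual W)).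
Implicit Types (v x y : ext V) (w : ext W) (psi : W) (m : V).

(** For x and w of the same degree, (m . w) . x has degree 1; taking the component of
    degree 1 makes sense of e(x, w) in all cases. *)
Definition eop_fun x w m : V := deg1 V (contr j (contr j' (ext_gen V m) w) x).

Fact eop_fun_linear x w : linear (eop_fun x w).
Proof.
move=> a m n.
by rewrite /eop_fun (homfP (ext_gen V)) !contr_linear (homfP (deg1 V)).
Qed.

Definition eop x w : hom V V := mkhom (eop_fun_linear x w).

Lemma eopE x w m : eop x w m = deg1 V (contr j (contr j' (ext_gen V m) w) x).
Proof. by []. Qed.

Lemma eop_linearl a x x' w : eop (a *: x + x') w = a *: eop x w + eop x' w.
Proof.
by apply: homP => m; rewrite homDE homZE !eopE (homfP (contr j _)) (homfP (deg1 V)).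
Qed.

Lemma eop_linearr a x w w' : eop x (a *: w + w') = a *: eop x w + eop x w'.
Proof.
apply: homP => m; rewrite homDE homZE !eopE (homfP (contr j' _)) contr_linear.
exact: homfP.
Qed.

Lemma der_eop x w (b : hom V V) (b' : hom W W) m :
    (forall p q, (j (b' p) : hom V k^o) q = (j p : hom V k^o) (b q)) ->
    (forall p q, (j p : hom V k^o) q = (j' q : hom W k^o) p) ->
  b (eop x w m) = eop x w (b m) + eop (der b x) w m - eop x (der b' w) m.
Proof.
move=> adj jj'; rewrite !eopE -deg1_der (contr_der _ _ adj).
have adj' p q : (j' (b p) : hom W k^o) q = (j' p : hom W k^o) (b' q).
  by rewrite -!jj' adj.
have := contr_der (ext_gen V m) w adj'; rewrite der_gen_eq => ->.
rewrite contrD contrN !(homfB (deg1 V)).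
abelian.
Qed.

Hypothesis jj' : forall p q, (j p : hom V k^o) q = (j' q : hom W k^o) p.

Lemma contr_prod3 (f1 f2 f3 : W) x :
  contr j (ext_gen W f1 * (ext_gen W f2 * ext_gen W f3)) x =
  antider (j f1) (antider (j f2) (antider (j f3) x)).
Proof. by rewrite !contrM !contr_gen. Qed.

Lemma der_eop_prod3 (f1 f2 f3 : W) x y : x \in homog V 3 ->
  der (eop x (ext_gen W f1 * (ext_gen W f2 * ext_gen W f3))) y =
    antider (j f2) (antider (j f3) x) * antider (j f1) y
  - antider (j f1) (antider (j f3) x) * antider (j f2) y
  + antider (j f1) (antider (j f2) x) * antider (j f3) y.
Proof.
move=> hx; pose c p q : V := deg1 V (antider (j p) (antider (j q) x)).
have cE p q : antider (j p) (antider (j q) x) = ext_gen V (c p q).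
  by apply: homog1_gen; do 2!apply: antider_homog.
have rk_linear p (n : V) : linear (fun m => ((j p : hom V k^o) m : k) *: n).
  by move=> a m m'; rewrite (homfP (j p : hom V k^o)) scalerDl scalerA.
pose rk p (n : V) : hom V V := mkhom (rk_linear p n).
have -> : eop x (ext_gen W f1 * (ext_gen W f2 * ext_gen W f3)) =
    (-1) *: rk f2 (c f1 f3) + (rk f1 (c f2 f3) + rk f3 (c f1 f2)).
  apply: homP => m; rewrite eopE contr_gen !(antiderM, antider_gen_eq).
  rewrite !ext_sign_gen -!jj' !mulNr mulrBr contrD contrN contrD contrN.
  rewrite !contrM !contr_cst !contr_gen.
  rewrite !(homfZ (antider _)) !(homfB (deg1 V)) !(homfZ (deg1 V)).
  have rkE p n : rk p n m = ((j p : hom V k^o) m : k) *: n by [].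
  rewrite !(homDE, homZE) !rkE scaleN1r /c; abelian.
have rkD p n : der (rk p n) y = ext_gen V n * antider (j p) y by exact: der_rank1.
by rewrite !derD derZ scaleN1r !rkD !cE addrCA addrA.
Qed.

(** The operators A_i contracting by f_i are antiderivations, so A_1 A_2 A_3 (x y)
    is a sum of eight terms: the two in which all three hit the same factor give
    the scalar terms, the others the endomorphisms e. *)
Lemma contr_mul3 w x y :
  w \in homog W 3 -> x \in homog V 3 -> y \in homog V 3 ->
  contr j w (x * y) =
    (der (eop y w) x - (deg0 V (contr j w y) : k) *: x)
  - (der (eop x w) y - (deg0 V (contr j w x) : k) *: y).
Proof.
move=> hw hx hy; elim/homog_ind: hw => [|a w1 w2 h1 h2|f].
- have e0 z : eop z 0 = 0.
    by have := eop_linearr (-1) z 0 0; rewrite scaler0 addr0 scaleN1r addNr.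
  by rewrite !contr0 (homf0 (deg0 V)) !scale0r !e0 !der_zero !subr0.
- rewrite !contr_linear h1 h2 !(homfP (deg0 V)) !eop_linearr !der_linear_arg.
  rewrite !homDE !homZE !scalerDl !scalerBr !scalerA.
  by rewrite -![a *: (deg0 V _)]/(a * _); abelian.
rewrite !big_ord_recl big_ord0 mulr1 !der_eop_prod3 // !contr_prod3.
set f1 := f _; set f2 := f _; set f3 := f _.
have sA1 p z : z \in homog V 3 -> ext_sign V (antider (j p) z) = antider (j p) z.
  by move=> hz; rewrite (ext_sign_even (i := 2)) // antider_homog.
have sA2 p q z : z \in homog V 3 ->
    ext_sign V (antider (j p) (antider (j q) z)) = - antider (j p) (antider (j q) z).
  by move=> hz; rewrite (ext_sign_odd (i := 1)) // !antider_homog.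
have cA p z t : z \in homog V 3 -> antider (j p) z * t = t * antider (j p) z.
  by move=> hz; rewrite (homog_even_comm (i := 2)) // antider_homog.
have A3 p q r z : z \in homog V 3 -> antider (j p) (antider (j q) (antider (j r) z))
   = ext_cst V (deg0 V (antider (j p) (antider (j q) (antider (j r) z)))).
  by move=> hz; apply: homog0_cst; rewrite !antider_homog.
rewrite antiderM (ext_sign_odd _ hx) // mulNr !(homfB (antider _)) !antiderM.
rewrite (ext_sign_odd _ hx) // !sA1 // mulNr !opprD opprK !(homfD (antider _)) !(homfN (antider _)).
rewrite !(antiderM (j f1)) (ext_sign_odd _ hx) // !sA2 // !sA1 // !mulNr.
rewrite (cA f1 x) // (cA f2 x) // (cA f3 x) //.
rewrite [in LHS](A3 f1 f2 f3 x hx) [in LHS](A3 f1 f2 f3 y hy).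
rewrite !ext_cstE -ext_scaleAl mul1r -ext_scaleAr mulr1.
abelian.
Qed.

Lemma eop_adj x w psi m :
  (j psi : hom V k^o) (eop x w m) =
  deg0 W (contr j' (antider (j psi) x) (ext_sign W (antider (j' m) w))).
Proof.
rewrite eopE -deg0_antider -contr_gen -contrM ext_gen_comm contrM !contr_gen.
by rewrite (deg0_contrC jj').
Qed.

End EMap.

(** Both sides pair the contraction of x by psi with that of w by m. *)
Lemma eop_adjoint (k : comPzRingType) (V W : lmodType k)
    (j : hom W (dual V)) (j' : hom V (dual W)) x w psi m :
    (forall p q, (j p : hom V k^o) q = (j' q : hom W k^o) p) ->
  (j (eop j' j w x psi) : hom V k^o) m = (j psi : hom V k^o) (eop j j' x w m).
Proof.
move=> jj'; rewrite eop_adj // jj' eopE -deg0_antider -!contr_gen.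
rewrite -contrM ext_gen_comm contrM -deg0_sign contr_sign ext_signK.
by rewrite !contr_gen.
Qed.

(** * Hodge duality *)

(** The dual basis writes a as the sum of the rank one maps h_i(-) a(g_i). *)
Lemma der_dual_basis (k : comPzRingType) (V W : lmodType k) (j : hom W (dual V))
    r (g : 'I_r -> V) (h : 'I_r -> W) (a : hom V V) (x : ext V) :
    (forall m, m = \sum_i ((j (h i) : hom V k^o) m : k) *: g i) ->
  der a x = \sum_i ext_gen V (a (g i)) * antider (j (h i)) x.
Proof.
move=> gh.
have rk_linear i : linear (fun m => ((j (h i) : hom V k^o) m : k) *: a (g i)).
  by move=> b m m'; rewrite (homfP (j (h i) : hom V k^o)) scalerDl scalerA.
have aE : a = \sum_i mkhom (rk_linear i).
  apply: homP => m; rewrite hom_sumE {1}(gh m) hom_sum.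
  by apply: eq_bigr => i _; exact: homfZ.
by rewrite {1}aE der_sum; apply: eq_bigr => i _; exact: der_rank1.
Qed.

(** All that is used of M, u and mu, with V = M and W its dual; the conditions are
    symmetric in V and W, and [dual_volumes_sym] transfers every consequence to
    the other side. *)
Record dual_volumes (k : comPzRingType) (V W : lmodType k)
    (j : hom W (dual V)) (j' : hom V (dual W)) (n : nat)
    (u : ext V) (mu : ext W) : Prop := DualVolumes {
  dv_pairing : forall p q, (j p : hom V k^o) q = (j' q : hom W k^o) p;
  dv_basis : exists r (g : 'I_r -> V) (h : 'I_r -> W),
    (forall m, m = \sum_i ((j (h i) : hom V k^o) m : k) *: g i) /\
    (forall p, p = \sum_i ((j' (g i) : hom W k^o) p : k) *: h i);
  dv_u : u \in homog V n;
  dv_mu : mu \in homog W n;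
  dv_top : forall i x, (n < i)%N -> x \in homog V i -> x = 0;
  dv_cotop : forall i w, (n < i)%N -> w \in homog W i -> w = 0;
  dv_mu_u : contr j mu u = 1;
  dv_u_mu : contr j' u mu = 1 }.

Lemma dual_volumes_sym (k : comPzRingType) (V W : lmodType k)
    (j : hom W (dual V)) (j' : hom V (dual W)) n u mu :
  dual_volumes j j' n u mu -> dual_volumes j' j n mu u.
Proof.
by case=> ? [r [g [h [? ?]]]] ? ? ? ? ? ?; split=> //; exists r, h, g.
Qed.

Section Hodge.
Variables (k : comPzRingType) (V W : lmodType k).
Variables (j : hom W (dual V)) (j' : hom V (dual W)) (n : nat).
Variables (u : ext V) (mu : ext W).
Hypothesis dv : dual_volumes j j' n u mu.
Implicit Types (v x y : ext V) (w : ext W) (psi : W) (m : V).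

(** Contracting the vanishing product m u by psi gives psi(m) u = m (psi . u);
    the general case follows by multiplicativity. *)
Lemma mul_contr_vol x w : x * contr j w u = contr j (contr j' x w) u.
Proof.
have um m : ext_gen V m * u = 0.
  have hmu := homogM (homog_gen m) (dv_u dv).
  by apply: (dv_top dv) hmu; rewrite add1n.
elim/ext_ind_gen: x w => [|a x y hx hy|m x hx] w.
- by rewrite contr1 mul1r.
- by rewrite mulrDl -ext_scaleAl hx hy !contr_linear.
rewrite -mulrA hx contrM contr_gen; move: (contr j' x w) => {x w hx} w.
elim/ext_ind_gen: w => [|a w w' hw hw'|psi w hw].
- by rewrite contr1 um antider1 contr0.
- rewrite (homfP (antider _)) !contr_linear mulrDr -ext_scaleAr.
  by rewrite hw hw'.
rewrite antiderM antider_gen_eq ext_sign_gen mulNr !contrD contrN !contrM !contr_gen.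
rewrite contr_cst -hw antiderM antider_gen_eq ext_sign_gen mulNr opprD opprK addrA.
by rewrite -(dv_pairing dv) subrr add0r.
Qed.

End Hodge.

Section HodgeDuality.
Variables (k : comPzRingType) (V W : lmodType k).
Variables (j : hom W (dual V)) (j' : hom V (dual W)) (n : nat).
Variables (u : ext V) (mu : ext W).
Hypothesis dv : dual_volumes j j' n u mu.
Implicit Types (v x y : ext V) (w : ext W) (psi : W) (m : V).

(** Contraction of u is a bijection Lambda(W) -> Lambda(V), with contraction of mu
    as inverse. *)
Lemma hodgeK w : contr j' (contr j w u) mu = w.
Proof.
rewrite -(mul_contr_vol (dual_volumes_sym dv)) (dv_u_mu dv).
exact: mulr1.
Qed.

Lemma hodgeK' v : contr j (contr j' v mu) u = v.
Proof. by rewrite -(mul_contr_vol dv) (dv_mu_u dv) [LHS]mulr1. Qed.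

Lemma top_homog x : x \in homog V n -> x = (deg0 V (contr j mu x) : k) *: u.
Proof.
move=> hx; rewrite (deg0_contrC (dv_pairing dv)) -(contr_cst j) -homog0_cst.
  rewrite -(mul_contr_vol dv) (dv_mu_u dv).
  exact/esym/mulr1.
by apply: contr_homog hx _; rewrite addn0; exact: dv_mu dv.
Qed.

(** A form killing its own degree kills mu by [contr_kill], so its Hodge dual
    vanishes. *)
Lemma pairing_nondeg i v :
    (i <= n)%N -> v \in homog V i ->
    (forall w, w \in homog W i -> deg0 V (contr j w v) = 0) ->
  v = 0.
Proof.
move=> lin hv kv.
rewrite -[v]hodgeK' (@contr_kill _ _ _ j j' (dv_pairing dv) i n v) ?contr0 //.
  move=> w hw; rewrite [LHS]homog0_cst -?(deg0_contrC (dv_pairing dv)).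
    by rewrite kv // ext_cstE scale0r.
  by apply: contr_homog hv _; rewrite addn0.
exact: dv_mu dv.
Qed.

Lemma vector_sep (m m' : V) :
  (forall psi, (j psi : hom V k^o) m = (j psi : hom V k^o) m') -> m = m'.
Proof.
move=> e; have [r [g [h [gh _]]]] := dv_basis dv.
by rewrite (gh m) (gh m'); apply: eq_bigr => i _; rewrite e.
Qed.

(** The dual action on Lambda(W) multiplies mu by the opposite of the trace, as the
    scalar mu . u is invariant. *)
Lemma der_dual_vol (a : hom V V) (a' : hom W W) (t : k) :
    (forall p q, (j (a' p) : hom V k^o) q = (j p : hom V k^o) (a q)) ->
  der a u = t *: u -> der a' mu = t *: mu.
Proof.
move=> adj au.
have := contr_der mu u adj; rewrite (dv_mu_u dv) der1 au (homfZ (contr j mu)).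
rewrite (dv_mu_u dv) => /esym/subr0_eq/(congr1 (fun z => contr j' z mu)).
by rewrite hodgeK contrZ contr1.
Qed.

(** The trace of e(x, w) on a dual basis (g_l, h_l) is the sum of the scalars
    (h_l (g_l . w)) . x, and the h_l (g_l . w) add up to D_1 w, that is to i w. *)
Lemma der_eop_vol i x w :
  x \in homog V i -> w \in homog W i ->
  der (eop j j' x w) u = ((deg0 V (contr j w x) : k) *+ i) *: u.
Proof.
move=> hx hw; have [r [g [h [gh hg]]]] := dv_basis dv.
rewrite (der_dual_basis _ _ gh).
have e l : ext_gen V (eop j j' x w (g l)) * antider (j (h l)) u =
    (deg0 V (contr j (ext_gen W (h l) * antider (j' (g l)) w) x) : k) *: u.
  rewrite -contr_gen (mul_contr_vol dv) contr_gen antider_gen_eq contr_cst.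
  by rewrite -(dv_pairing dv) eopE -deg0_antider -contr_gen -contrM contr_gen.
rewrite (eq_bigr _ (fun l _ => e l)) -scaler_suml.
congr (_ *: u).
have -> : (deg0 V (contr j w x) : k) *+ i = deg0 V (contr j (w *+ i) x).
  elim: i {hx hw} => [|i IH]; first by rewrite !mulr0n contr0 (homf0 (deg0 V)).
  by rewrite !mulrS contrD (homfD (deg0 V)) -IH.
rewrite -(der_one_homog hw) (der_dual_basis (hom_id W) w hg) contr_sum hom_sum.
by [].
Qed.

End HodgeDuality.

(** * The operators delta(x, w) *)

Section Delta.
Variables (k : comPzRingType) (V W : lmodType k).
Variables (j : hom W (dual V)) (j' : hom V (dual W)).
Hypothesis jj' : forall p q, (j p : hom V k^o) q = (j' q : hom W k^o) p.
Implicit Types (x y z : ext V) (w : ext W).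

Definition delta_op x w : hom (ext V) (ext V) :=
  der (eop j j' x w) - (deg0 V (contr j w x) : k) *: hom_id (ext V).

Lemma delta_opE x w y :
  delta_op x w y = der (eop j j' x w) y - (deg0 V (contr j w x) : k) *: y.
Proof. by []. Qed.

Lemma delta_op_linearl a x x' w y :
  delta_op (a *: x + x') w y = a *: delta_op x w y + delta_op x' w y.
Proof.
rewrite !delta_opE eop_linearl derD derZ (homfP (contr j w)) (homfP (deg0 V)).
by rewrite scalerDl scalerBr scalerA; abelian.
Qed.

Lemma delta_op_linearr a x w w' y :
  delta_op x (a *: w + w') y = a *: delta_op x w y + delta_op x w' y.
Proof.
rewrite !delta_opE eop_linearr derD derZ contr_linear (homfP (deg0 V)).
by rewrite scalerDl scalerBr scalerA; abelian.
Qed.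

Lemma delta_opDl c x x' w y :
  delta_op (x + c *: x') w y = delta_op x w y + c *: delta_op x' w y.
Proof. by rewrite addrC delta_op_linearl addrC. Qed.

Lemma delta_opBr c x w w' y :
  delta_op x (- w - c *: w') y = - delta_op x w y - c *: delta_op x w' y.
Proof.
have d0 : delta_op x 0 y = 0.
  by have := delta_op_linearr (-1) x 0 0 y; rewrite scaler0 addr0 scaleN1r addNr.
have dN (z : ext W) : delta_op x (- z) y = - delta_op x z y.
  by have := delta_op_linearr (-1) x z 0 y; rewrite d0 !addr0 !scaleN1r.
by rewrite -!opprD dN addrC delta_op_linearr addrC.
Qed.

Lemma contr_mul_delta w x y :
  w \in homog W 3 -> x \in homog V 3 -> y \in homog V 3 ->
  contr j w (x * y) = delta_op y w x - delta_op x w y.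
Proof. exact: contr_mul3. Qed.

Lemma der_commutator (a b : hom V V) x :
  der (a * b - b * a) x = der a (der b x) - der b (der a x).
Proof.
elim/ext_ind_gen: x => [|c x y hx hy|m x hx].
- by rewrite !der1 !(homf0 (der _)) subr0.
- by rewrite !(homfP (der _)) hx hy scalerBr; abelian.
rewrite derM hx der_gen_eq (derM b) (derM a) !(homfD (der _)) !derM !der_gen_eq.
by rewrite homDE homNE !homME (homfB (ext_gen V)) mulrBl mulrBr; abelian.
Qed.

(** Both e(x, w) and the scalar w . x are built from invariant operations. *)
Lemma delta_op_equiv (b : hom V V) (b' : hom W W) x w y :
    (forall p q, (j (b' p) : hom V k^o) q = (j p : hom V k^o) (b q)) ->
  der b (delta_op x w y) - delta_op x w (der b y) =
  delta_op (der b x) w y - delta_op x (der b' w) y.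
Proof.
move=> adj.
have e : b * eop j j' x w - eop j j' x w * b =
    eop j j' (der b x) w - eop j j' x (der b' w).
  apply: homP => m; rewrite !(homDE, homNE) !homME (der_eop _ _ _ adj jj').
  by abelian.
have s : deg0 V (contr j w (der b x)) = deg0 V (contr j (der b' w) x).
  apply: subr0_eq; rewrite -(homfB (deg0 V)) -(contr_der _ _ adj).
  exact: deg0_der.
have := der_commutator b (eop j j' x w) y; rewrite e.
have -> : eop j j' (der b x) w - eop j j' x (der b' w) =
    (-1) *: eop j j' x (der b' w) + eop j j' (der b x) w.
  by rewrite addrC scaleN1r.
rewrite der_linear_arg scaleN1r homDE homNE => e'.
rewrite !delta_opE (homfB (der b)) (homfZ (der b)) s.
apply: etrans (etrans (esym e') _); abelian.
Qed.

End Delta.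

Section CyclicSums.
Variables (k : comPzRingType) (V W : lmodType k).
Variables (j : hom W (dual V)) (j' : hom V (dual W)).
Variables (u : ext V) (mu : ext W).
Hypothesis dv : dual_volumes j j' 9 u mu.

(** By Hodge duality e((w2 w3) . u, w1) m is the contraction of u by
    (m . w1) w2 w3, so the cyclic sum is the contraction of u by
    m . (w1 w2 w3), which is m times the scalar (w1 w2 w3) . u. *)
Lemma eop_cyclic_vol w1 w2 w3 m :
  w1 \in homog W 3 -> w2 \in homog W 3 -> w3 \in homog W 3 ->
  eop j j' (contr j (w2 * w3) u) w1 m + eop j j' (contr j (w3 * w1) u) w2 m
  + eop j j' (contr j (w1 * w2) u) w3 m
  = (deg0 V (contr j (w1 * w2 * w3) u) : k) *: m.
Proof.
move=> h1 h2 h3.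
rewrite !eopE -!contrM -!(homfD (deg1 V)) -!contrD contr_gen.
have -> : antider (j' m) w1 * (w2 * w3) + antider (j' m) w2 * (w3 * w1)
    + antider (j' m) w3 * (w1 * w2) = antider (j' m) (w1 * (w2 * w3)).
  have h2' := antider_homog (j' m) h2; have h3' := antider_homog (j' m) h3.
  rewrite !antiderM (ext_sign_odd _ h1) // (ext_sign_odd _ h2) // !mulNr mulrBr opprB.
  rewrite (homog_odd_anti _ _ h1 h3) // mulrN (mulrA (antider (j' m) w2)).
  rewrite (homog_even_comm w1 _ h2') // (homog_even_comm (w1 * w2) _ h3') //.
  by rewrite !mulrA addrAC addrA.
have h : contr j (w1 * (w2 * w3)) u \in homog V 0.
  by apply: contr_homog (homogM h1 (homogM h2 h3)) _; exact: dv_u dv.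
rewrite -contr_gen -(mul_contr_vol dv) -[w1 * w2 * w3]mulrA (homog0_cst h).
by rewrite deg1M deg0_gen deg1_gen scale0r add0r.
Qed.

End CyclicSums.

Section CyclicDelta.
Variables (k : comPzRingType) (V W : lmodType k).
Variables (j : hom W (dual V)) (j' : hom V (dual W)).
Variables (u : ext V) (mu : ext W).
Hypothesis dv : dual_volumes j j' 9 u mu.

(** The adjoint of [eop_cyclic_vol] with the roles of V and W exchanged. *)
Lemma eop_cyclic_covol x1 x2 x3 m :
  x1 \in homog V 3 -> x2 \in homog V 3 -> x3 \in homog V 3 ->
  eop j j' x1 (contr j' (x2 * x3) mu) m + eop j j' x2 (contr j' (x3 * x1) mu) m
  + eop j j' x3 (contr j' (x1 * x2) mu) m
  = (deg0 W (contr j' (x1 * x2 * x3) mu) : k) *: m.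
Proof.
move=> h1 h2 h3; apply: (vector_sep dv) => psi.
rewrite !(homfD (j psi : hom V k^o)) (homfZ (j psi : hom V k^o)).
rewrite -!(eop_adjoint _ _ _ _ (dv_pairing dv)) !(dv_pairing dv) -!(homfD (j' m : hom W k^o)).
by rewrite (eop_cyclic_vol (dual_volumes_sym dv)) // (homfZ (j' m : hom W k^o)).
Qed.

Lemma homog3_rot (U : lmodType k) (a b c : ext U) :
  a \in homog U 3 -> b \in homog U 3 -> c \in homog U 3 ->
  a * (b * c) = b * (c * a).
Proof.
by move=> ha hb hc; rewrite -(homog_even_comm _ _ (homogM hb hc)) // mulrA.
Qed.

(** On degree 3, the derivation extending t times the identity is multiplication by
    3 t, which cancels the three scalars. *)
Lemma delta_of_scalar (e1 e2 e3 : hom V V) (t s1 s2 s3 : k) y :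
    (forall m, e1 m + e2 m + e3 m = t *: m) -> s1 = t -> s2 = t -> s3 = t ->
    y \in homog V 3 ->
  (der e1 y - s1 *: y) + (der e2 y - s2 *: y) + (der e3 y - s3 *: y) = 0.
Proof.
move=> e -> -> -> hy.
rewrite [X in X + (_ - _)]addrACA [LHS]addrACA -!opprD -!derD.
have -> : e1 + e2 + e3 = t *: hom_id V.
  by apply: homP => m; rewrite !homDE e.
by rewrite derZ (der_one_homog hy) -scalerMnr !mulrS mulr0n addr0 addrA subrr.
Qed.

Lemma delta_cyclic_vol w1 w2 w3 y :
  w1 \in homog W 3 -> w2 \in homog W 3 -> w3 \in homog W 3 -> y \in homog V 3 ->
  delta_op j j' (contr j (w2 * w3) u) w1 y
  + delta_op j j' (contr j (w3 * w1) u) w2 y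
  + delta_op j j' (contr j (w1 * w2) u) w3 y = 0.
Proof.
move=> h1 h2 h3; apply: delta_of_scalar (fun m => eop_cyclic_vol dv m h1 h2 h3) _ _ _.
- by rewrite -contrM mulrA.
- by rewrite -contrM (homog3_rot h2 h3 h1) (homog3_rot h3 h1 h2) mulrA.
- by rewrite -contrM (homog3_rot h3 h1 h2) mulrA.
Qed.

Lemma delta_cyclic_covol x1 x2 x3 y :
  x1 \in homog V 3 -> x2 \in homog V 3 -> x3 \in homog V 3 -> y \in homog V 3 ->
  delta_op j j' x1 (contr j' (x2 * x3) mu) y
  + delta_op j j' x2 (contr j' (x3 * x1) mu) y
  + delta_op j j' x3 (contr j' (x1 * x2) mu) y = 0.
Proof.
move=> h1 h2 h3; apply: delta_of_scalar (fun m => eop_cyclic_covol m h1 h2 h3) _ _ _;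
  rewrite (deg0_contrC (dv_pairing dv)) -contrM.
- by rewrite mulrA.
- by rewrite (homog3_rot h2 h3 h1) (homog3_rot h3 h1 h2) mulrA.
- by rewrite (homog3_rot h3 h1 h2) mulrA.
Qed.

End CyclicDelta.

(** * Lie algebras with three summands *)

(** Up to cyclic permutations and transpositions, the summands of three arguments
    can be sorted, which leaves ten cases. *)
Lemma three_summands_eq0 (G H : zmodType) (A X Y : Type)
    (ia : A -> G) (ix : X -> G) (iy : Y -> G) (J : G -> G -> G -> H) :
    (forall P : G -> Prop, (forall a, P (ia a)) -> (forall x, P (ix x)) ->
      (forall y, P (iy y)) -> (forall u v, P u -> P v -> P (u + v)) ->
      forall u, P u) ->
    (forall u v w, J u v w = 0 -> J v w u = 0) ->
    (forall u v w, J u v w = 0 -> J v u w = 0) ->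
    (forall u u' v w, J u v w = 0 -> J u' v w = 0 -> J (u + u') v w = 0) ->
    (forall a b c, J (ia a) (ia b) (ia c) = 0) ->
    (forall a b x, J (ia a) (ia b) (ix x) = 0) ->
    (forall a b y, J (ia a) (ia b) (iy y) = 0) ->
    (forall a x x', J (ia a) (ix x) (ix x') = 0) ->
    (forall a x y, J (ia a) (ix x) (iy y) = 0) ->
    (forall a y y', J (ia a) (iy y) (iy y') = 0) ->
    (forall x x' x'', J (ix x) (ix x') (ix x'') = 0) ->
    (forall x x' y, J (ix x) (ix x') (iy y) = 0) ->
    (forall x y y', J (ix x) (iy y) (iy y') = 0) ->
    (forall y y' y'', J (iy y) (iy y') (iy y'') = 0) ->
  forall p q r, J p q r = 0.
Proof.
move=> gen Jcyc Jskew JD Jaaa Jaax Jaay Jaxx Jaxy Jayy Jxxx Jxxy Jxyy Jyyy p q r.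
elim/gen: p => [a|x|y|u v hu hv]; last exact: JD.
all: elim/gen: q => [b|x'|y'|u v hu hv];
  last by apply/Jcyc/Jcyc/JD; apply: (Jcyc).
all: elim/gen: r => [c|x''|y''|u v hu hv];
  last by apply/Jcyc/JD; apply/Jcyc/Jcyc.
all: let base := first [exact: Jaaa|exact: Jaax|exact: Jaay|exact: Jaxx|exact: Jaxy
       |exact: Jayy|exact: Jxxx|exact: Jxxy|exact: Jxyy|exact: Jyyy] in
  first [base|apply: (Jskew); base|apply: (Jcyc); first [base|apply: (Jskew); base]
        |apply: (Jcyc); apply: (Jcyc); first [base|apply: (Jskew); base]].
Qed.

Section ThreePartLie.
Variables (k : comPzRingType) (A X Y : lmodType k).

Definition bilin (U V W : lmodType k) (f : U -> V -> W) : Prop :=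
  (forall a x y z, f (a *: x + y) z = a *: f x z + f y z) /\
  (forall a x y z, f z (a *: x + y) = a *: f z x + f z y).

Variables (aa : A -> A -> A) (ax : A -> X -> X) (ay : A -> Y -> Y).
Variables (xx : X -> X -> Y) (yy : Y -> Y -> X) (xy : X -> Y -> A).

(** The general shape of an alternating product on A + X + Y that is graded by Z/3,
    with A, X and Y in degrees 0, 1 and -1. *)
Definition three_part_bracket (p q : A * X * Y) : A * X * Y :=
  (aa p.1.1 q.1.1 + (xy p.1.2 q.2 - xy q.1.2 p.2),
   ax p.1.1 q.1.2 - ax q.1.1 p.1.2 + yy p.2 q.2,
   ay p.1.1 q.2 - ay q.1.1 p.2 + xx p.1.2 q.1.2).

Hypotheses (aa_bilin : bilin aa) (ax_bilin : bilin ax) (ay_bilin : bilin ay)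
  (xx_bilin : bilin xx) (yy_bilin : bilin yy) (xy_bilin : bilin xy).
Hypotheses (aa_alt : forall a, aa a a = 0) (xx_alt : forall x, xx x x = 0)
  (yy_alt : forall y, yy y y = 0).
Hypotheses
  (jac_aaa : forall a b c, aa a (aa b c) + aa b (aa c a) + aa c (aa a b) = 0)
  (jac_aax : forall a b x, ax (aa a b) x = ax a (ax b x) - ax b (ax a x))
  (jac_aay : forall a b y, ay (aa a b) y = ay a (ay b y) - ay b (ay a y))
  (jac_axx : forall a x x', ay a (xx x x') = xx (ax a x) x' + xx x (ax a x'))
  (jac_ayy : forall a y y', ax a (yy y y') = yy (ay a y) y' + yy y (ay a y'))
  (jac_axy : forall a x y, aa a (xy x y) = xy (ax a x) y + xy x (ay a y))
  (jac_xxx : forall x1 x2 x3,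
    xy x1 (xx x2 x3) + xy x2 (xx x3 x1) + xy x3 (xx x1 x2) = 0)
  (jac_yyy : forall y1 y2 y3,
    xy (yy y2 y3) y1 + xy (yy y3 y1) y2 + xy (yy y1 y2) y3 = 0)
  (jac_xxy : forall x x' y, yy (xx x x') y = ax (xy x y) x' - ax (xy x' y) x)
  (jac_xyy : forall x y y', xx x (yy y y') = ay (xy x y) y' - ay (xy x y') y).

Section BilinLemmas.
Variables (U V W : lmodType k) (f : U -> V -> W).
Hypothesis fb : bilin f.

Lemma bilin0l v : f 0 v = 0.
Proof. by have := fb.1 (-1) 0 0 v; rewrite scaler0 addr0 scaleN1r addNr. Qed.
Lemma bilin0r u : f u 0 = 0.
Proof. by have := fb.2 (-1) 0 0 u; rewrite scaler0 addr0 scaleN1r addNr. Qed.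
Lemma bilinNr u v : f u (- v) = - f u v.
Proof. by have := fb.2 (-1) v 0 u; rewrite bilin0r !addr0 !scaleN1r. Qed.
Lemma bilinNl u v : f (- u) v = - f u v.
Proof. by have := fb.1 (-1) u 0 v; rewrite bilin0l !addr0 !scaleN1r. Qed.
Lemma bilinDl u u' v : f (u + u') v = f u v + f u' v.
Proof. by have := fb.1 1 u u' v; rewrite !scale1r. Qed.
Lemma bilinDr u v v' : f u (v + v') = f u v + f u v'.
Proof. by have := fb.2 1 v v' u; rewrite !scale1r. Qed.

Lemma bilin_alt_skew (g : U -> U -> V) u v :
  bilin g -> (forall z, g z z = 0) -> g v u = - g u v.
Proof.
move=> [g1 g2] alt; have := alt (u + v).
have D1 p q r : g (p + q) r = g p r + g q r by have := g1 1 p q r; rewrite !scale1r.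
have D2 p q r : g r (p + q) = g r p + g r q by have := g2 1 p q r; rewrite !scale1r.
rewrite D1 !D2 !alt add0r addr0 => /eqP; rewrite addrC addr_eq0 => /eqP.
exact.
Qed.

End BilinLemmas.

Local Notation G := (A * X * Y)%type.
Local Notation br := three_part_bracket.

Lemma three_part_bilin : bilin br.
Proof.
split=> c [[a x] y] [[a' x'] y'] [[b z] t]; rewrite /br /=.
  rewrite (aa_bilin.1) (ax_bilin.1) (ay_bilin.1) (xx_bilin.1) (yy_bilin.1) (xy_bilin.1).
  rewrite (ax_bilin.2) (ay_bilin.2) (xy_bilin.2).
  by congr (_, _, _); rewrite /= !scalerDr ?scalerN; abelian.
rewrite (aa_bilin.2) (ax_bilin.2) (ay_bilin.2) (xx_bilin.2) (yy_bilin.2) (xy_bilin.2).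
rewrite (ax_bilin.1) (ay_bilin.1) (xy_bilin.1).
by congr (_, _, _); rewrite /= !scalerDr ?scalerN; abelian.
Qed.

Lemma three_part_alt p : br p p = 0.
Proof.
by case: p => [[a x] y]; rewrite /br /= aa_alt xx_alt yy_alt !subrr !addr0.
Qed.

Let G_eq (u v : G) : u.1.1 = v.1.1 -> u.1.2 = v.1.2 -> u.2 = v.2 -> u = v.
Proof. by case: u v => [[? ?] ?] [[? ?] ?] /= -> -> ->. Qed.

Let ia (a : A) : G := (a, 0, 0).
Let ix (x : X) : G := (0, x, 0).
Let iy (y : Y) : G := (0, 0, y).

Let b0 := (bilin0l aa_bilin, bilin0l ax_bilin, bilin0l ay_bilin, bilin0l xx_bilin,
  bilin0l yy_bilin, bilin0l xy_bilin, bilin0r aa_bilin, bilin0r ax_bilin,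
  bilin0r ay_bilin, bilin0r xx_bilin, bilin0r yy_bilin, bilin0r xy_bilin).

Lemma three_part_pure :
  (forall a b, br (ia a) (ia b) = ia (aa a b)) *
  (forall a x, br (ia a) (ix x) = ix (ax a x)) *
  (forall a y, br (ia a) (iy y) = iy (ay a y)) *
  (forall a x, br (ix x) (ia a) = ix (- ax a x)) *
  (forall a y, br (iy y) (ia a) = iy (- ay a y)) *
  (forall x x', br (ix x) (ix x') = iy (xx x x')) *
  (forall y y', br (iy y) (iy y') = ix (yy y y')) *
  (forall x y, br (ix x) (iy y) = ia (xy x y)) *
  (forall x y, br (iy y) (ix x) = ia (- xy x y)).
Proof.
by do !split; move=> *; rewrite /br /ia /ix /iy /= !b0 ?oppr0 ?addr0 ?add0r.
Qed.

(** The Jacobi sum J is trilinear, cyclic and alternating, so it is enough to know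
    it on the ten sorted triples of pure elements; each is one of the hypotheses,
    up to the antisymmetry of the bracket. *)
Lemma three_part_jacobi p q r :
  br p (br q r) + br q (br r p) + br r (br p q) = 0.
Proof.
pose J p q r : G := br p (br q r) + br q (br r p) + br r (br p q).
have bD := bilinDl three_part_bilin; have bD' := bilinDr three_part_bilin.
have bN := bilinNr three_part_bilin.
have skew u v : br v u = - br u v by exact: bilin_alt_skew three_part_bilin three_part_alt.
have Jcyc u v w : J u v w = 0 -> J v w u = 0 by rewrite /J => <-; rewrite addrC addrA.
have Jskew u v w : J u v w = 0 -> J v u w = 0.
  rewrite /J => e; apply: oppr_inj; rewrite oppr0 -[RHS]e.
  by rewrite (skew w u) (skew u v) (skew v w) !bN; abelian.
have JD u u' v w : J u v w = 0 -> J u' v w = 0 -> J (u + u') v w = 0.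
  move=> h h'; have -> : J (u + u') v w = J u v w + J u' v w.
    by rewrite /J !(bD, bD'); abelian.
  by rewrite h h' addr0.
have iD : (forall a b, ia a + ia b = ia (a + b)) * (forall a b, ix a + ix b = ix (a + b))
  * (forall a b, iy a + iy b = iy (a + b)).
  by do !split; move=> *; apply: G_eq; rewrite //= addr0.
have xskew u v : xx v u = - xx u v := bilin_alt_skew u v xx_bilin xx_alt.
have yskew u v : yy v u = - yy u v := bilin_alt_skew u v yy_bilin yy_alt.
have opp := (bilinNr ax_bilin, bilinNr ay_bilin, bilinNr xx_bilin, bilinNr yy_bilin,
  bilinNr xy_bilin, bilinNl ax_bilin, bilinNl ay_bilin).
have Jaaa a b c : J (ia a) (ia b) (ia c) = 0.
  by rewrite /J !three_part_pure !iD; apply: (congr1 ia (y := 0)).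
have Jaax a b x : J (ia a) (ia b) (ix x) = 0.
  rewrite /J !three_part_pure !iD; apply: (congr1 ix (y := 0)); rewrite jac_aax !opp; abelian.
have Jaay a b y : J (ia a) (ia b) (iy y) = 0.
  rewrite /J !three_part_pure !iD; apply: (congr1 iy (y := 0)); rewrite jac_aay !opp; abelian.
have Jaxx a x x' : J (ia a) (ix x) (ix x') = 0.
  rewrite /J !three_part_pure !iD; apply: (congr1 iy (y := 0)).
  rewrite jac_axx (xskew _ x') opp; abelian.
have Jayy a y y' : J (ia a) (iy y) (iy y') = 0.
  rewrite /J !three_part_pure !iD; apply: (congr1 ix (y := 0)).
  rewrite jac_ayy (yskew _ y') opp; abelian.
have Jaxy a x y : J (ia a) (ix x) (iy y) = 0.
  rewrite /J !three_part_pure !iD; apply: (congr1 ia (y := 0)); rewrite jac_axy opp; abelian.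
have Jxxx x1 x2 x3 : J (ix x1) (ix x2) (ix x3) = 0.
  by rewrite /J !three_part_pure !iD; apply: (congr1 ia (y := 0)).
have Jyyy y1 y2 y3 : J (iy y1) (iy y2) (iy y3) = 0.
  rewrite /J !three_part_pure !iD; apply: (congr1 ia (y := 0)).
  by rewrite -!opprD jac_yyy oppr0.
have Jxxy x x' y : J (ix x) (ix x') (iy y) = 0.
  rewrite /J !three_part_pure !iD; apply: (congr1 ix (y := 0)).
  rewrite (yskew _ y) jac_xxy !opp; abelian.
have Jxyy x y y' : J (ix x) (iy y) (iy y') = 0.
  rewrite /J !three_part_pure !iD; apply: (congr1 iy (y := 0)).
  rewrite jac_xyy !opp; abelian.
have split3 u : u = ia u.1.1 + ix u.1.2 + iy u.2.
  by apply: G_eq; rewrite /= ?addr0 ?add0r.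
have gen (P : G -> Prop) : (forall a, P (ia a)) -> (forall x, P (ix x)) ->
    (forall y, P (iy y)) -> (forall u v, P u -> P v -> P (u + v)) -> forall u, P u.
  by move=> Pa Px Py PD u; rewrite (split3 u); apply: (PD); first exact: PD.
exact: (@three_summands_eq0 _ _ _ _ _ ia ix iy J gen).
Qed.

Lemma three_part_lie : lie_product (L := (A * X * Y)%type) br.
Proof.
by split; [exact: three_part_bilin.1|exact: three_part_bilin.2
  |exact: three_part_alt|exact: three_part_jacobi].
Qed.

End ThreePartLie.

(** * Graded components and the algebra sl *)

Section GradedProjections.
Variables (k : comPzRingType) (M : lmodType k).

(* A vector acts on the sequences of elements of Lambda(M) by multiplication and a
   shift; the square of this action is zero, so it extends to Lambda(M), and x sends
   (1, 0, 0, ...) to the sequence of its homogeneous components. *)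
Local Notation S := (nat -> ext M).

Definition shift_fun (m : M) (s : S) : S :=
  fun n => if n is n'.+1 then ext_gen M m * s n' else 0.

Fact shift_fun_linear m : linear (shift_fun m).
Proof.
move=> a s t; apply: funext => -[|n] /=.
  have e : a *: (0 : ext M) + 0 = 0 by rewrite scaler0 addr0.
  exact/esym/e.
by rewrite [LHS]mulrDr -ext_scaleAr.
Qed.

Definition shift (m : M) : hom S S := mkhom (shift_fun_linear m).

Definition scalar_end (a : k) : hom S S := a *: hom_id S.

Definition graded_act : ext M -> hom S S := ext_lift scalar_end shift.

Lemma scalar_endE a s n : scalar_end a s n = a *: s n.
Proof. by []. Qed.
Lemma shiftE m s n : shift m s n = if n is n'.+1 then ext_gen M m * s n' else 0.
Proof. by []. Qed.
Lemma hom_addE (f g : hom S S) s n : (f + g) s n = f s n + g s n.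
Proof. by []. Qed.
Lemma hom_ext (f g : hom S S) : (forall s n, f s n = g s n) -> f = g.
Proof. by move=> fg; apply: homP => s; apply: funext => n. Qed.

Fact scalar_end1 : scalar_end 1 = 1.
Proof. by apply: hom_ext => s n; rewrite scalar_endE scale1r. Qed.
Fact scalar_endD : {morph scalar_end : a b / a + b}.
Proof. by move=> a b; apply: hom_ext => s n; rewrite hom_addE !scalar_endE scalerDl. Qed.
Fact scalar_endM : {morph scalar_end : a b / a * b}.
Proof. by move=> a b; apply: hom_ext => s n; rewrite homME !scalar_endE scalerA. Qed.
Fact scalar_endC a f : scalar_end a * f = f * scalar_end a.
Proof.
apply: hom_ext => s n; rewrite !homME scalar_endE.
have -> : scalar_end a s = a *: s by [].
by rewrite (homfZ f).
Qed.
Fact shiftD : {morph shift : m n / m + n}.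
Proof.
move=> m n; apply: hom_ext => s [|i]; rewrite hom_addE !shiftE ?addr0 //.
by rewrite (homfD (ext_gen M)) mulrDl.
Qed.
Fact shiftZ a m : shift (a *: m) = scalar_end a * shift m.
Proof.
apply: hom_ext => s [|i]; rewrite homME scalar_endE !shiftE ?scaler0 //.
by rewrite (homfZ (ext_gen M)) -ext_scaleAl.
Qed.
Fact shift_sqr m : shift m * shift m = 0.
Proof.
apply: hom_ext => s [|[|i]] //; rewrite homME !shiftE; first by rewrite mulr0.
by rewrite mulrA ext_gen_sqr mul0r.
Qed.

Let lift_D := ext_liftD scalar_end1 scalar_endD scalar_endM scalar_endC shiftD shiftZ shift_sqr.
Let lift_M := ext_liftM scalar_end1 scalar_endD scalar_endM scalar_endC shiftD shiftZ shift_sqr.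
Let lift_1 := ext_lift1 scalar_end1 scalar_endD scalar_endM scalar_endC shiftD shiftZ shift_sqr.
Let lift_Z := ext_liftZ scalar_end1 scalar_endD scalar_endM scalar_endC shiftD shiftZ shift_sqr.
Let lift_gen := ext_lift_gen scalar_end1 scalar_endD scalar_endM scalar_endC shiftD shiftZ shift_sqr.

Definition proj_fun (i : nat) (x : ext M) : ext M :=
  graded_act x (fun n => if n == 0%N then 1 else 0) i.

Fact proj_linear i : linear (proj_fun i).
Proof. by move=> a x y; rewrite /proj_fun /graded_act lift_D lift_Z. Qed.

Definition proj (i : nat) : hom (ext M) (ext M) := mkhom (proj_linear i).

Lemma proj_homog i n x : x \in homog M n -> proj i x = if i == n then x else 0.
Proof.
elim/homog_ind => [|a y z ey ez|v].
- by rewrite (homf0 (proj i)) if_same.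
- by rewrite (homfP (proj i)) ey ez; case: eqP; rewrite // scaler0 addr0.
rewrite -[proj i _]/(graded_act _ _ i).
elim: n i v => [|n IH] i v; first by rewrite big_ord0 /graded_act lift_1 hom1E.
rewrite big_ord_recl /graded_act lift_M lift_gen homME.
case: i => [|i] //=.
rewrite -[LHS]/(ext_gen M _ * graded_act (\prod_(l < n) _) _ i) IH eqSS.
by case: eqP; rewrite // mulr0.
Qed.

End GradedProjections.

Section CharacterizeSl.
Variables (k : comPzRingType) (M : lmodType k).
Variables (u : gr M 9) (mu : gr (dual M) 9).
Hypothesis top0 : forall i (x : ext M), (9 < i)%N -> x \in homog M i -> x = 0.
Hypothesis mu_u : lact (gr_val mu) (gr_val u) = 1.

(** The derivation of the subalgebra of the Lambda_3i that extends the identity of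
    Lambda_3. Three times it is D_1, but 3 need not be invertible. *)
Definition euler3 : hom (ext M) (ext M) :=
  locked (proj M 3 + (2%:R *: proj M 6 + 3%:R *: proj M 9)).

Lemma euler3_homog i x : (i <= 3)%N -> x \in homog M (3 * i) -> euler3 x = x *+ i.
Proof.
move=> i3 hx.
rewrite /euler3 -lock !homDE !homZE !(proj_homog _ hx).
by case: i i3 {hx} => [|[|[|[|]]]] //= _;
  rewrite ?scaler0 ?scaler_nat ?mulr0n ?mulr1n ?addr0 ?add0r.
Qed.

Lemma in_ext3_ind (P : ext M -> Prop) :
    (forall i x, (i <= 3)%N -> x \in homog M (3 * i) -> P x) ->
    (forall x y, P x -> P y -> P (x + y)) ->
  forall x, in_ext3 x -> P x.
Proof.
move=> Ph PD x [x0 [x3 [x6 [x9 ->]]]].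
apply: (PD); last exact: (Ph 3 _ _ (gr_homog x9)).
apply: (PD); last exact: (Ph 2 _ _ (gr_homog x6)).
apply: (PD); last exact: (Ph 1%N _ _ (gr_homog x3)).
exact: (Ph 0%N _ _ (gr_homog x0)).
Qed.

Lemma in_ext3_homog i x : (i <= 3)%N -> x \in homog M (3 * i) -> in_ext3 x.
Proof.
move=> i3 hx; apply: (in_ext3_gr (Gr hx)).
by case: i i3 {hx} => [|[|[|[|]]]].
Qed.

(** In total degree above 9 both sides vanish, whatever the multiplicities. *)
Lemma euler3M x y : in_ext3 x -> in_ext3 y ->
  euler3 (x * y) = euler3 x * y + x * euler3 y.
Proof.
move=> hx hy; elim/in_ext3_ind: hx => [i {}x i3 hx|x1 x2 h1 h2]; last first.
  by rewrite mulrDl !(homfD euler3) h1 h2 !mulrDl; abelian.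
elim/in_ext3_ind: hy => [l {}y l3 hy|y1 y2 h1 h2]; last first.
  by rewrite mulrDr !(homfD euler3) h1 h2 !mulrDr; abelian.
rewrite (euler3_homog i3 hx) (euler3_homog l3 hy) mulrnAl mulrnAr -mulrnDr.
have hxy : x * y \in homog M (3 * (i + l)) by rewrite mulnDr; exact: homogM.
have [il3|il3] := leqP (i + l) 3; first exact: euler3_homog.
rewrite (top0 _ hxy) ?mul0rn ?(homf0 euler3) //.
by apply: (@leq_trans (3 * 4)) => //; rewrite leq_mul2l.
Qed.

Lemma extends_to_der_gl (a : hom M M) (c : k) :
  extends_to_der (rho a + c *: hom_id (gr M 3))
    (fun x => der a x + c *: euler3 x).
Proof.
split.
- move=> x; elim/in_ext3_ind => [i {}x i3 hx|x1 x2 h1 h2].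
    rewrite (euler3_homog i3 hx) -scaler_nat scalerA.
    rewrite addrC; apply: in_ext3_linear; first exact: in_ext3_homog hx.
    exact: (in_ext3_homog i3 (der_homog a hx)).
  rewrite (homfD (der a)) (homfD euler3) scalerDr addrACA -[X in X + _]scale1r.
  exact: in_ext3_linear.
- move=> b x y _ _; rewrite (homfP (der a)) (homfP euler3) !scalerDr !scalerA mulrC.
  by abelian.
- move=> x y hx hy; rewrite derM euler3M // !scalerDr mulrDl mulrDr.
  by rewrite ext_scaleAl ext_scaleAr; abelian.
- move=> x; rewrite (@euler3_homog 1) ?mulr1n //; exact: gr_homog.
Qed.

(** Since the extended derivation is unique, T can be computed with the explicit one:
    T(rho a + c) = t + 3 c when D_a u = t u. *)
Lemma in_slP (beta : hom (gr M 3) (gr M 3)) :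
    (forall x, x \in homog M 9 -> exists t : k, x = t *: gr_val u) ->
  beta \in in_sl mu u <->
  exists (a : hom M M) (c t : k),
    [/\ beta = rho a + c *: hom_id (gr M 3), der a (gr_val u) = t *: gr_val u
      & t + c *+ 3 = 0].
Proof.
move=> hu.
have T (a : hom M M) (c t : k) : der a (gr_val u) = t *: gr_val u ->
    lact (gr_val mu) (der a (gr_val u) + c *: euler3 (gr_val u)) = ext_cst M (t + c *+ 3).
  move=> ->; rewrite (@euler3_homog 3) ?gr_homog //.
  rewrite -scaler_nat scalerA -scalerDl (homfZ (lact (gr_val mu))) mu_u ext_cstE.
  by rewrite mulr_natr.
split=> [/asboolP[[a [c ->]] [d hd dt]]|[a [c [t [-> hat tc]]]]].
  have [t hat] := hu _ (der_homog a (gr_homog u)); exists a, c, t; split=> //.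
  have := T a c t hat.
  have -> := extends_to_der_unique (extends_to_der_gl a c) hd (in_ext3_gr u isT).
  rewrite dt => /(congr1 (deg0 M)); rewrite !deg0_cst.
  exact.
apply: asboolT; split; first by exists a, c.
exists (fun x => der a x + c *: euler3 x); first exact: extends_to_der_gl.
by rewrite (T _ _ _ hat) tc.
Qed.

End CharacterizeSl.

(** * The components of the bracket *)

Section Duality.
Variables (k : comPzRingType) (M : lmodType k).
Implicit Types (x y : ext M) (xi : ext (dual M)).

(* The two pairings: [lact] is the contraction along jd, [ract] that along je. *)
Local Notation jd := (hom_id (dual M)).
Local Notation je := (evdual M).

Lemma ext_map_id (N : lmodType k) (x : ext N) : ext_map (hom_id N) x = x.
Proof.
elim/ext_ind_gen: x => [|a x y hx hy|m x hx]; first exact: ext_map1.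
  by rewrite (homfP (ext_map _)) hx hy.
by rewrite ext_mapM ext_map_gen hx.
Qed.

Lemma lactE xi : lact xi = contr jd xi.
Proof. by rewrite /contr ext_map_id. Qed.

Lemma ractE x : ract x = contr je x.
Proof. by []. Qed.

Lemma e_mapE x xi : e_map x xi = eop jd je x xi.
Proof. by apply: homP => m; rewrite eopE -lactE. Qed.

Lemma evdualE (p : dual M) (q : M) :
  (jd p : hom M k^o) q = (je q : hom (dual M) k^o) p.
Proof. by []. Qed.

Fact adjoint_linear (a : hom M M) : linear (fun p : dual M => hom_comp p a : dual M).
Proof. by move=> b p q; apply: homP. Qed.

Definition adjoint (a : hom M M) : hom (dual M) (dual M) := mkhom (adjoint_linear a).

Lemma adjointE (a : hom M M) (p : dual M) q :
  (jd (adjoint a p) : hom M k^o) q = (jd p : hom M k^o) (a q).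
Proof. by []. Qed.

Lemma adjointE' (a : hom M M) (p : M) (q : dual M) :
  (je (a p) : hom (dual M) k^o) q = (je p : hom (dual M) k^o) (adjoint a q).
Proof. by []. Qed.

Lemma volumes_dual (u : gr M 9) (mu : gr (dual M) 9) :
  finitely_generated M -> projective M -> has_rank M 9 ->
  lact (gr_val mu) (gr_val u) = 1 -> dual_volumes jd je 9 (gr_val u) (gr_val mu).
Proof.
move=> fg proj rk; rewrite lactE => mu_u; split=> //.
- have [n [g [h gh]]] := dual_basis fg proj; exists n, g, h; split=> // p.
  apply: homP => m; rewrite hom_sumE {1}(gh m) hom_sum; apply: eq_bigr => i _.
  by rewrite (homfZ (p : hom M k^o)) homZE [LHS]mulrC.
- exact: gr_homog.
- exact: gr_homog.
- by move=> i x; exact: (homog_rank_eq0 fg rk).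
- by move=> i x; exact: (homog_dual_rank_eq0 fg proj rk).
have h : contr je (gr_val u) (gr_val mu) \in homog (dual M) 0.
  by apply: contr_homog (gr_homog u) _; exact: gr_homog.
by rewrite (homog0_cst h) -(deg0_contrC evdualE) mu_u deg0_1.
Qed.

End Duality.

Lemma hom_commutatorE (k : comPzRingType) (U : lmodType k) (f g : hom U U) x :
  (f * g - g * f) x = f (g x) - g (f x).
Proof. by []. Qed.
Lemma grB (k : comPzRingType) (U : lmodType k) i (x y : gr U i) :
  gr_val (x - y) = gr_val x - gr_val y.
Proof. by []. Qed.
Lemma grN (k : comPzRingType) (U : lmodType k) i (x : gr U i) :
  gr_val (- x) = - gr_val x.
Proof. by []. Qed.

Section Bracket.
(* The components are named after the summands A, X and Y of their arguments. *)
Variables (k : comPzRingType) (M : lmodType k) (u : gr M 9) (mu : gr (dual M) 9).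
Local Notation jd := (hom_id (dual M)).
Local Notation je := (evdual M).
Local Notation X := (gr M 3).
Local Notation Y := (gr (dual M) 3).
Local Notation A := (sl mu u).
Hypothesis dv : dual_volumes jd je 9 (gr_val u) (gr_val mu).

Let dv' := dual_volumes_sym dv.

Lemma slP (beta : hom X X) : beta \in in_sl mu u <->
  exists (a : hom M M) (c t : k),
    [/\ beta = rho a + c *: hom_id X, der a (gr_val u) = t *: gr_val u & t + c *+ 3 = 0].
Proof.
apply: in_slP.
- exact: (dv_top dv).
- by rewrite lactE (dv_mu_u dv).
- by move=> x hx; exists (deg0 M (contr jd (gr_val mu) x)); exact: (top_homog dv).
Qed.

Lemma deltaE (x : X) (xi : Y) y :
  gr_val (delta x xi y) = delta_op jd je (gr_val x) (gr_val xi) (gr_val y).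
Proof.
rewrite delta_opE (deg0_contrC (@evdualE _ M)) -e_mapE.
by [].
Qed.

Lemma gl_apply (a : hom M M) (c : k) (x : X) :
  gr_val ((rho a + c *: hom_id X) x) = der a (gr_val x) + c *: gr_val x.
Proof. by []. Qed.

Lemma gl_commutator (a a' : hom M M) (c c' : k) :
  (rho a + c *: hom_id X) * (rho a' + c' *: hom_id X)
  - (rho a' + c' *: hom_id X) * (rho a + c *: hom_id X)
  = rho (a * a' - a' * a) + 0 *: hom_id X.
Proof.
move: (gl_apply a c) (gl_apply a' c') (gl_apply (a * a' - a' * a) 0).
set B := rho a + c *: hom_id X; set C := rho a' + c' *: hom_id X.
set D := rho (a * a' - a' * a) + 0 *: hom_id X.
move: B C D => B C D BE CE DE.
apply: homP => x; rewrite hom_commutatorE; apply: val_inj.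
rewrite [LHS]grB [RHS]DE !(BE, CE) der_commutator.
rewrite !(homfD (der _)) !(homfZ (der _)) !scalerDr !scalerA scale0r addr0 [c' * c]mulrC.
by abelian.
Qed.

Lemma commutator_in_sl (b c : A) : sl_val b * sl_val c - sl_val c * sl_val b \in in_sl mu u.
Proof.
have /slP[a [s [t [-> at_ _]]]] := sl_axiom b.
have /slP[a' [s' [t' [-> at'_ _]]]] := sl_axiom c.
apply/slP; exists (a * a' - a' * a), 0, 0; split; last by rewrite mul0rn addr0.
- exact: gl_commutator.
- rewrite der_commutator at_ at'_ !(homfZ (der _)) at_ at'_ !scalerA mulrC subrr.
  by rewrite scale0r.
Qed.

(** T(delta(x, xi)) is tr e(x, xi) - 3 (x . xi), which vanishes by [der_eop_vol]. *)
Lemma delta_in_sl (x : X) (xi : Y) : delta x xi \in in_sl mu u.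
Proof.
apply/slP; pose s : k := deg0 M (contr jd (gr_val xi) (gr_val x)).
exists (e_map (gr_val x) (gr_val xi)), (- s), (s *+ 3); split.
- by rewrite /delta scaleNr -(deg0_contrC (@evdualE _ M)).
- by rewrite e_mapE (der_eop_vol dv (gr_homog x) (gr_homog xi)).
- by rewrite mulNrn subrr.
Qed.

Lemma vol_contr_homog (x y : X) :
  contr je (gr_val x * gr_val y) (gr_val mu) \in homog (dual M) 3.
Proof. exact: contr_homog (homogM (gr_homog x) (gr_homog y)) (gr_homog mu). Qed.

Lemma covol_contr_homog (xi psi : Y) :
  contr jd (gr_val xi * gr_val psi) (gr_val u) \in homog M 3.
Proof. exact: contr_homog (homogM (gr_homog xi) (gr_homog psi)) (gr_homog u). Qed.

(** Locked, so that these elements are not compared through the proofs that they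
    carry. *)
Definition brXX (x y : X) : Y := locked (Gr (vol_contr_homog x y)).
Definition brYY (xi psi : Y) : X := locked (Gr (covol_contr_homog xi psi)).
Definition brXY (x : X) (xi : Y) : A := locked (Sl (delta_in_sl x xi)).
Definition brAA (b c : A) : A := locked (Sl (commutator_in_sl b c)).
Definition brAX (b : A) (x : X) : X := sl_val b x.

Lemma brXX_val x y : gr_val (brXX x y) = contr je (gr_val x * gr_val y) (gr_val mu).
Proof. by rewrite /brXX -lock. Qed.
Lemma brYY_val xi psi : gr_val (brYY xi psi) = contr jd (gr_val xi * gr_val psi) (gr_val u).
Proof. by rewrite /brYY -lock. Qed.
Lemma brXY_val x xi : sl_val (brXY x xi) = delta x xi.
Proof. by rewrite /brXY -lock. Qed.
Lemma brAA_val b c : sl_val (brAA b c) = sl_val b * sl_val c - sl_val c * sl_val b.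
Proof. by rewrite /brAA -lock. Qed.

Lemma gr_pairE (xi : Y) (x : X) :
  gr_pair xi x = deg0 M (contr jd (gr_val xi) (gr_val x)).
Proof. by rewrite -lactE. Qed.

Lemma gr_pair_inj (xi psi : Y) : gr_pair xi = gr_pair psi -> xi = psi.
Proof.
move=> e; apply: val_inj; apply: subr0_eq.
apply: (@pairing_nondeg _ _ _ _ _ _ _ _ dv' 3) => //.
  by exact: (gr_homog (xi - psi)).
move=> x hx; rewrite -(deg0_contrC (@evdualE _ M)) contrD contrN (homfB (deg0 M)).
have := congr1 (fun f : dual X => (f : hom X k^o) (Gr hx)) e.
by rewrite !gr_pairE => ->; rewrite subrr.
Qed.

Lemma dual_action_homog (a : hom M M) (c : k) (xi : Y) :
  - der (adjoint a) (gr_val xi) - c *: gr_val xi \in homog (dual M) 3.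
Proof.
rewrite -scaleN1r -scaleNr; apply: homogD; apply: homogZ; last exact: gr_homog.
by apply: der_homog; exact: gr_homog.
Qed.

(** The transposed action is the dual action of rho a + c, by the invariance of the
    pairing. *)
Lemma gr_pair_dual_action (b : hom X X) (a : hom M M) (c : k) (xi : Y) :
    (forall x, gr_val (b x) = der a (gr_val x) + c *: gr_val x) ->
  gr_pair (Gr (dual_action_homog a c xi)) = - transpose b (gr_pair xi).
Proof.
move=> bE; apply: homP => x; rewrite homNE.
rewrite -[transpose b _ x]/(gr_pair xi (b x)) !gr_pairE bE.
rewrite contrD !contrN contrZ.
rewrite (homfD (contr jd _)) (homfZ (contr jd _)) !(homfD (deg0 M)).
have := deg0_der a (contr jd (gr_val xi) (gr_val x)).
rewrite (contr_der _ _ (adjointE a)) (homfB (deg0 M)) => /subr0_eq ->.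
by rewrite !(homfN (deg0 M)) opprD.
Qed.

Lemma sl_decomp (b : A) : exists (a : hom M M) (c : k),
  (forall x, gr_val (sl_val b x) = der a (gr_val x) + c *: gr_val x) /\
  der a (gr_val u) = (- (c *+ 3)) *: gr_val u.
Proof.
have /slP[a [c [t [-> hat tc]]]] := sl_axiom b; exists a, c; split=> //.
by have -> : - (c *+ 3) = t by apply/esym/eqP; rewrite -addr_eq0 tc.
Qed.

Lemma dual_action_ex (b : A) (xi : Y) :
  exists eta : Y, gr_pair eta = - transpose (sl_val b) (gr_pair xi).
Proof.
have [a [c [bE _]]] := sl_decomp b.
by exists (Gr (dual_action_homog a c xi)); exact: gr_pair_dual_action.
Qed.

(** The element is unique by [gr_pair_inj], so that laws for it can be checked after
    pairing, independently of the choice of a and c with b = rho a + c. *)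
Definition brAY (b : A) (xi : Y) : Y := projT1 (cid (dual_action_ex b xi)).

Lemma brAYE (b : A) (xi : Y) : gr_pair (brAY b xi) = - transpose (sl_val b) (gr_pair xi).
Proof. by rewrite /brAY; case: cid. Qed.

Lemma brAY_apply (b : A) (xi : Y) x : gr_pair (brAY b xi) x = - gr_pair xi (sl_val b x).
Proof. by rewrite brAYE. Qed.

Lemma brAY_val (b : A) (xi : Y) a (c : k) :
    (forall x, gr_val (sl_val b x) = der a (gr_val x) + c *: gr_val x) ->
  gr_val (brAY b xi) = - der (adjoint a) (gr_val xi) - c *: gr_val xi.
Proof.
move=> bE; have -> // : brAY b xi = Gr (dual_action_homog a c xi).
by apply: gr_pair_inj; rewrite brAYE (gr_pair_dual_action _ bE).
Qed.

End Bracket.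

(** * Bilinearity and the Jacobi identities *)

Section BracketLaws.
Variables (k : comPzRingType) (M : lmodType k) (u : gr M 9) (mu : gr (dual M) 9).
Local Notation jd := (hom_id (dual M)).
Local Notation je := (evdual M).
Local Notation X := (gr M 3).
Local Notation Y := (gr (dual M) 3).
Local Notation A := (sl mu u).
Hypothesis dv : dual_volumes jd je 9 (gr_val u) (gr_val mu).

Let dv' := dual_volumes_sym dv.
Local Notation xx := (brXX mu).
Local Notation yy := (brYY u).
Local Notation xy := (brXY dv).
Local Notation aa := (brAA dv).
Local Notation ax := (@brAX k M u mu).
Local Notation ay := (brAY dv).

Lemma gr_eq (U : lmodType k) i (x y : gr U i) : gr_val x = gr_val y -> x = y.
Proof. exact: val_inj. Qed.

Lemma brXX_bilin : bilin xx.
Proof.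
split=> a x y z; apply: gr_eq; rewrite [RHS]grD grZ !brXX_val grD grZ.
  by rewrite mulrDl -ext_scaleAl contr_linear.
by rewrite mulrDr -ext_scaleAr contr_linear.
Qed.

Lemma brYY_bilin : bilin yy.
Proof.
split=> a x y z; apply: gr_eq; rewrite [RHS]grD grZ !brYY_val grD grZ.
  by rewrite mulrDl -ext_scaleAl contr_linear.
by rewrite mulrDr -ext_scaleAr contr_linear.
Qed.

Lemma sl_eq (b c : A) : (forall x, gr_val (sl_val b x) = gr_val (sl_val c x)) -> b = c.
Proof. by move=> e; apply: val_inj; apply: homP => x; apply: gr_eq; exact: e. Qed.

Lemma sl_linearE (a : k) (b c : A) x :
  gr_val (sl_val (a *: b + c) x) = a *: gr_val (sl_val b x) + gr_val (sl_val c x).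
Proof. by []. Qed.

Lemma xyE x xi z :
  gr_val (sl_val (xy x xi) z) = delta_op jd je (gr_val x) (gr_val xi) (gr_val z).
Proof. by rewrite brXY_val deltaE. Qed.

Lemma aaE b c x :
  sl_val (aa b c) x = sl_val b (sl_val c x) - sl_val c (sl_val b x).
Proof. by rewrite brAA_val hom_commutatorE. Qed.

Lemma brXY_bilin : bilin xy.
Proof.
split=> a x y z; apply: sl_eq => t; rewrite sl_linearE !xyE grD grZ.
  exact: delta_op_linearl.
exact: delta_op_linearr.
Qed.

Lemma brAX_bilin : bilin ax.
Proof. by split=> a x y z; rewrite /brAX // (homfP (sl_val z)). Qed.

Lemma brAA_bilin : bilin aa.
Proof.
split=> a x y z; apply: sl_eq => t; rewrite sl_linearE !aaE.
  rewrite -[sl_val (a *: x + y) _]/(a *: sl_val x _ + sl_val y _).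
  rewrite -[sl_val (a *: x + y) _]/(a *: sl_val x _ + sl_val y _).
  rewrite (homfP (sl_val z)) !grB !grD !grZ scalerBr; abelian.
rewrite -[sl_val (a *: x + y) _]/(a *: sl_val x _ + sl_val y _).
rewrite -[sl_val (a *: x + y) _]/(a *: sl_val x _ + sl_val y _).
rewrite (homfP (sl_val z)) !grB !grD !grZ scalerBr; abelian.
Qed.

Lemma gr_pair_linear_arg (a : k) (xi psi : Y) z :
  gr_pair (a *: xi + psi) z = a *: gr_pair xi z + gr_pair psi z.
Proof. by rewrite !gr_pairE grD grZ contr_linear (homfP (deg0 M)). Qed.

Lemma brAY_bilin : bilin ay.
Proof.
split=> a x y z; apply: (gr_pair_inj dv); apply: homP => t.
  rewrite gr_pair_linear_arg !brAY_apply.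
  rewrite -[sl_val (a *: x + y) _]/(a *: sl_val x _ + sl_val y _).
  by rewrite (homfP (gr_pair z)) opprD scalerN.
by rewrite gr_pair_linear_arg !brAY_apply gr_pair_linear_arg opprD scalerN.
Qed.

Lemma brAA_alt b : aa b b = 0.
Proof. by apply: sl_eq => t; rewrite aaE subrr. Qed.

Lemma brXX_alt x : xx x x = 0.
Proof.
apply: gr_eq; rewrite brXX_val (homog_odd_sqr _ (gr_homog x)) //.
exact: contr0.
Qed.

Lemma brYY_alt xi : yy xi xi = 0.
Proof.
apply: gr_eq; rewrite brYY_val (homog_odd_sqr _ (gr_homog xi)) //.
exact: contr0.
Qed.

Lemma jacobi_AAA b c d : aa b (aa c d) + aa c (aa d b) + aa d (aa b c) = 0.
Proof.
apply: sl_eq => t.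
rewrite -[sl_val (_ + _ + _) _]/(sl_val _ _ + sl_val _ _ + sl_val _ _) !aaE.
rewrite !(homfB (sl_val _)) !(grD, grN).
transitivity (0 : ext M) => //; abelian.
Qed.

Lemma jacobi_AAX b c x : ax (aa b c) x = ax b (ax c x) - ax c (ax b x).
Proof. exact: aaE. Qed.

Lemma gr_pairB (xi psi : Y) z : gr_pair (xi - psi) z = gr_pair xi z - gr_pair psi z.
Proof.
by have := gr_pair_linear_arg (-1) psi xi z; rewrite !scaleN1r addrC [RHS]addrC.
Qed.

Lemma jacobi_AAY b c xi : ay (aa b c) xi = ay b (ay c xi) - ay c (ay b xi).
Proof.
apply: (gr_pair_inj dv); apply: homP => t.
rewrite gr_pairB !brAY_apply aaE (homfB (gr_pair xi)); abelian.
Qed.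

(** Contraction of mu commutes with D_a up to the trace t of a, and the scalar c
    contributes 2 c on one side and - c on the other: what remains is t + 3 c = 0. *)
Lemma jacobi_AXX b x y : ay b (xx x y) = xx (ax b x) y + xx x (ax b y).
Proof.
have [a [c [bE hat]]] := sl_decomp dv b.
apply: gr_eq; rewrite (brAY_val dv _ bE) [RHS]grD !brXX_val /brAX !bE.
have hmu := der_dual_vol dv (adjointE a) hat.
rewrite (contr_der _ _ (adjointE' a)) hmu (homfZ (contr je _)) derM.
rewrite mulrDl mulrDr -ext_scaleAl -ext_scaleAr !contrD !contrZ.
set q := c *: _; have -> z : (c *- 3) *: z = - (c *: z + c *: z + c *: z).
  by rewrite scaleNr !mulrSr mulr0n add0r !scalerDl.
by rewrite -/q opprB opprK -(addrA _ (q + q + q)) addrK addrACA.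
Qed.

Lemma jacobi_AYY b xi psi : ax b (yy xi psi) = yy (ay b xi) psi + yy xi (ay b psi).
Proof.
have [a [c [bE hat]]] := sl_decomp dv b.
apply: gr_eq; rewrite [RHS]grD !brYY_val !(brAY_val dv _ bE) /brAX bE brYY_val.
rewrite (contr_der _ _ (adjointE a)) hat (homfZ (contr jd _)) derM.
rewrite mulrBl mulrBr (mulNr (der _ _)) (mulrN _ (der _ _)).
rewrite -(ext_scaleAl c) -(ext_scaleAr c) !contrD !contrN !contrZ.
set q := c *: _; have -> z : (c *- 3) *: z = - (c *: z + c *: z + c *: z).
  by rewrite scaleNr !mulrSr mulr0n add0r !scalerDl.
rewrite -/q addrACA -!opprD; apply: oppr_inj; rewrite opprD !opprK.
by rewrite !opprD !opprK addrAC addrK addrC.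
Qed.

Lemma jacobi_AXY b x xi : aa b (xy x xi) = xy (ax b x) xi + xy x (ay b xi).
Proof.
have [a [c [bE hat]]] := sl_decomp dv b.
apply: sl_eq => y; rewrite aaE grB.
rewrite -[sl_val (xy _ _ + xy _ _) _]/(sl_val (xy _ _) _ + sl_val (xy _ _) _) grD.
rewrite !xyE (brAY_val dv _ bE) /brAX !bE xyE.
rewrite (homfD (delta_op _ _ _ _)) (homfZ (delta_op _ _ _ _)).
rewrite (@delta_opDl _ _ _ jd je c (der a (gr_val x)) (gr_val x) (gr_val xi) (gr_val y)).
rewrite (@delta_opBr _ _ _ jd je c (gr_val x) (der (adjoint a) (gr_val xi))
  (gr_val xi) (gr_val y)).
have := delta_op_equiv (@evdualE _ M) (gr_val x) (gr_val xi) (gr_val y) (adjointE a).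
move=> e; transitivity (der a (delta_op jd je (gr_val x) (gr_val xi) (gr_val y))
    - delta_op jd je (gr_val x) (gr_val xi) (der a (gr_val y))); first by abelian.
by rewrite e; abelian.
Qed.

Lemma jacobi_XXX x1 x2 x3 : xy x1 (xx x2 x3) + xy x2 (xx x3 x1) + xy x3 (xx x1 x2) = 0.
Proof.
apply: sl_eq => y.
rewrite -[sl_val (_ + _ + _) _]/(sl_val _ _ + sl_val _ _ + sl_val _ _) !grD !xyE !brXX_val.
exact: (delta_cyclic_covol dv (gr_homog _) (gr_homog _) (gr_homog _) (gr_homog _)).
Qed.

Lemma jacobi_YYY w1 w2 w3 : xy (yy w2 w3) w1 + xy (yy w3 w1) w2 + xy (yy w1 w2) w3 = 0.
Proof.
apply: sl_eq => y.
rewrite -[sl_val (_ + _ + _) _]/(sl_val _ _ + sl_val _ _ + sl_val _ _) !grD !xyE !brYY_val.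
exact: (delta_cyclic_vol dv (gr_homog _) (gr_homog _) (gr_homog _) (gr_homog _)).
Qed.

(** Both sides are minus the contraction of x y by xi: the left one by Hodge duality,
    after exchanging two factors of degree 3, the right one by [contr_mul_delta]. *)
Lemma jacobi_XXY x y xi : yy (xx x y) xi = ax (xy x xi) y - ax (xy y xi) x.
Proof.
apply: gr_eq; rewrite [RHS]grB /brAX !xyE brYY_val brXX_val.
rewrite (homog_odd_anti _ _ (gr_homog xi) (vol_contr_homog mu x y)) //.
rewrite contrN contrM (hodgeK' dv).
rewrite (contr_mul_delta (@evdualE _ M)) ?gr_homog // opprB.
by [].
Qed.

(** The dual action of delta(x, w) is minus the operator delta(w, x) of the exchanged
    pair, which reduces the identity to that of [jacobi_XXY] for the dual module. *)
Lemma jacobi_XYY x xi psi : xx x (yy xi psi) = ay (xy x xi) psi - ay (xy x psi) xi.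
Proof.
have act w z : gr_val (ay (xy x w) z) = - delta_op je jd (gr_val w) (gr_val x) (gr_val z).
  have bE t : gr_val (sl_val (xy x w) t) = der (e_map (gr_val x) (gr_val w)) (gr_val t)
      + (- (deg0 M (contr jd (gr_val w) (gr_val x)) : k)) *: gr_val t.
    by rewrite xyE delta_opE e_mapE scaleNr.
  rewrite (brAY_val dv _ bE) delta_opE (deg0_contrC (@evdualE _ M)) scaleNr opprB opprK.
  have -> : adjoint (e_map (gr_val x) (gr_val w)) = eop je jd (gr_val w) (gr_val x).
    apply: homP => p; apply: homP => m; rewrite e_mapE.
    exact/esym/(eop_adjoint _ _ _ _ (@evdualE _ M)).
  by rewrite addrC.
apply: gr_eq; rewrite [RHS]grB !act brXX_val brYY_val.
rewrite contrM (hodgeK dv) (contr_mul_delta (dv_pairing dv')) ?gr_homog //.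
by abelian.
Qed.

End BracketLaws.

(** * The Lie algebra *)

Theorem theorem5 (k : comPzRingType) (M : lmodType k)
    (M_fg : finitely_generated M) (M_proj : projective M)
    (M_rank : has_rank M 9)
    (u : gr M 9) (mu : gr (dual M) 9)
    (mu_u : lact (gr_val mu) (gr_val u) = 1) :
  exists br : G mu u -> G mu u -> G mu u,
    [/\ lie_product br,
      [/\ forall alpha beta : sl mu u,
            exists2 gamma : sl mu u,
              sl_val gamma = sl_val alpha * sl_val beta - sl_val beta * sl_val alpha
            & br (of_sl alpha) (of_sl beta) = of_sl gamma,
          forall (alpha : sl mu u) (x : gr M 3),
            br (of_sl alpha) (of_gr mu u x) = of_gr mu u (sl_val alpha x)
        & forall (alpha : sl mu u) (xi : gr (dual M) 3),
            exists2 eta : gr (dual M) 3,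
              gr_pair eta = - transpose (sl_val alpha) (gr_pair xi)
            & br (of_sl alpha) (of_dual mu u xi) = of_dual mu u eta]
    & [/\ forall x y : gr M 3,
            exists2 xi : gr (dual M) 3,
              gr_val xi = ract (gr_val x * gr_val y) (gr_val mu)
            & br (of_gr mu u x) (of_gr mu u y) = of_dual mu u xi,
          forall xi psi : gr (dual M) 3,
            exists2 x : gr M 3,
              gr_val x = lact (gr_val xi * gr_val psi) (gr_val u)
            & br (of_dual mu u xi) (of_dual mu u psi) = of_gr mu u x
        & forall (x : gr M 3) (xi : gr (dual M) 3),
            exists2 alpha : sl mu u,
              sl_val alpha = delta x xi
            & br (of_gr mu u x) (of_dual mu u xi) = of_sl alpha]].
Proof.
have dv := volumes_dual M_fg M_proj M_rank mu_u.
have pure := three_part_pure (brAA_bilin dv) (@brAX_bilin _ _ u mu) (brAY_bilin dv)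
  (brXX_bilin mu) (brYY_bilin u) (brXY_bilin dv).
exists (three_part_bracket (brAA dv) (@brAX _ _ u mu) (brAY dv) (brXX mu) (brYY u)
  (brXY dv)); split.
- apply: three_part_lie.
  + exact: brAA_bilin.
  + exact: brAX_bilin.
  + exact: brAY_bilin.
  + exact: brXX_bilin.
  + exact: brYY_bilin.
  + exact: brXY_bilin.
  + exact: brAA_alt.
  + exact: brXX_alt.
  + exact: brYY_alt.
  + exact: jacobi_AAA.
  + exact: jacobi_AAX.
  + exact: jacobi_AAY.
  + exact: jacobi_AXX.
  + exact: jacobi_AYY.
  + exact: jacobi_AXY.
  + exact: jacobi_XXX.
  + exact: jacobi_YYY.
  + exact: jacobi_XXY.
  + exact: jacobi_XYY.
- split=> [b c|b x|b xi].
  + by exists (brAA dv b c); [exact: brAA_val|by rewrite /of_sl /of_gr /of_dual pure].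
  + by rewrite /of_sl /of_gr /of_dual pure.
  + by exists (brAY dv b xi); [exact: brAYE|by rewrite /of_sl /of_gr /of_dual pure].
split=> [x y|xi psi|x xi].
- by exists (brXX mu x y); [rewrite brXX_val ractE|by rewrite /of_sl /of_gr /of_dual pure].
- by exists (brYY u xi psi); [rewrite brYY_val lactE|by rewrite /of_sl /of_gr /of_dual pure].
- by exists (brXY dv x xi); [exact: brXY_val|by rewrite /of_sl /of_gr /of_dual pure].
Qed.
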